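(* Let $n\ge2$, $t\in\mathbb{N}$, and let $\mathcal{P}\subset[n]$ be nonempty. Suppose the following hold. (1) $A=A_0/\sqrt n$, where $A_0$ is a symmetric $n\times n$ random matrix and the entries of its upper triangle are independent mean $0$ random variables with $\max_{i,j\in[n]}\|A_{0,ij}\|_{\psi_2}\le K$ for some $K\ge2$. (2) $\max_{s\in[t]}\max_{\mathsf{H}_s\in\{\mathsf{F}_s,\mathsf{G}_s\}}\max_{\ell\in[n]}\max\{\|\mathsf{H}_{s,\ell}\|_{\mathrm{Lip}},|\mathsf{H}_{s,\ell}(0)|\}\le\Lambda$ for some $\Lambda\ge2$. Then there exists a universal constant $c_0>0$ such that for $x\ge0$, $$\mathbb{P}\Big(\|z^{(t)}-z^{(t)}_{[-\mathcal{P}]}\|\ge|\mathcal{P}|\big(c_0K\Lambda(1+\sqrt{x/n})\big)^{t+1}\sqrt x\cdot\big(1+\max_{k\in\mathcal{P}}|z^{(0)}_k|+n^{-1/2}\|z^{(0)}\|\big)\,\Big|\,z^{(0)}\Big)\le c_0\,t\,|\mathcal{P}|\,e^{-x/c_0}.$$ Moreover, $$\max_{k\in[n]}\mathbb{P}\Big(|z^{(t)}_k|\ge\big(c_0K\Lambda(1+\sqrt{x/n})\big)^{t+1}(1+\sqrt x)\cdot(1+\|z^{(0)}\|_\infty)\,\Big|\,z^{(0)}\Big)\le c_0\,t\,e^{-x/c_0}.$$ Consequently, for any $p\ge1$ there exists $C_p>1$ such that $$\max\Big\{\max_{k\in[n]}\mathbb{E}^{1/p}\big[|z^{(t)}_k|^p\,\big|\,z^{(0)}\big],\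 \frac{\mathbb{E}^{1/p}\big[\|z^{(t)}\|_\infty^p\,\big|\,z^{(0)}\big]}{(\log n)^{2t}}\Big\}\le(C_p\,tK\Lambda)^{t+1}(1+\|z^{(0)}\|_\infty).$$
   Context: Notation: for integers $a\le b$, $[a:b]=\{a,\dots,b\}$, $[n]=[1:n]$. $\|X\|_{\psi_2}$ is the sub-Gaussian Orlicz norm; $\|\cdot\|$ the Euclidean norm; $\|\cdot\|_{\mathrm{Lip}}$ the Lipschitz constant. $\mathbb{E}^{1/p}[\cdot]=(\mathbb{E}[\cdot])^{1/p}$. GFOM iterates: from $z^{(0)}\in\mathbb{R}^n$ independent of $A$, for $t=1,2,\dots$, $$z^{(t)}=A\,\mathsf{F}_t(z^{(0)},\dots,z^{(t-1)})+\mathsf{G}_t(z^{(0)},\dots,z^{(t-1)})\in\mathbb{R}^n,$$ where $\mathsf{F}_t,\mathsf{G}_t:\mathbb{R}^{n\times[0:t-1]}\to\mathbb{R}^n$ are row-separate: their $\ell$-th components are functions $\mathsf{F}_{t,\ell},\mathsf{G}_{t,\ell}:\mathbb{R}^{[0:t-1]}\to\mathbb{R}$ of the $\ell$-th row $(z^{(0)}_\ell,\dots,z^{(t-1)}_\ell)$ only. Leave-$k$-out iterates: $A_{[-\mathcal{P}]}=(A_{ij}\mathbf{1}_{i,j\notin\mathcal{P}})_{i,j}\in\mathbb{R}^{n\times n}$, and $z^{(t)}_{[-\mathcal{P}]}$ is generated by the same recursion with $A$ replaced by $A_{[-\mathcal{P}]}$ and the same initialization $z^{(0)}_{[-\mathcal{P}]}=z^{(0)}$.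 *)

(* Defs.v *)
From HB Require Import structures.
From mathcomp Require Import all_boot all_order all_algebra.
From mathcomp Require Import all_classical all_reals all_analysis measurable_realfun.

Set Implicit Arguments.
Unset Strict Implicit.
Unset Printing Implicit Defensive.

Import Order.TTheory GRing.Theory Num.Theory.
Import numFieldNormedType.Exports.

Local Open Scope classical_set_scope.
Local Open Scope ring_scope.

(* The library norm `|v| on matrices is the sup norm, hence a separate
   Euclidean norm. *)
Definition norm2 {R : realType} {m n : nat} (v : 'M[R]_(m, n)) : R :=
  Num.sqrt (\sum_i \sum_j v i j ^+ 2).

(* Lipschitz constant with respect to the Euclidean norm, in [0, +oo]
   (for s > 0). *)
Definition lip_norm {R : realType} {s : nat} (f : 'rV[R]_s -> R) : \bar R :=
  ereal_sup [set r | exists u v : 'rV[R]_s,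
    u <> v /\ r = (`|f u - f v| / norm2 (u - v))%:E].

Section Probability.
Context {d : measure_display} {T : measurableType d} {R : realType}.
Variable P : probability T R.

(* ||X||_{psi_2} = inf {C > 0 | E exp (X^2 / C^2) <= 2}, +oo if there is no
   such C. *)
Definition psi2_norm (X : T -> R) : \bar R :=
  ereal_inf [set C%:E | C in [set C : R |
    0 < C /\ ('E_P[fun w => expR ((X w / C) ^+ 2)] <= 2%:E)%E]].

(* Mutual independence of the family (X i)_{i in D}. *)
Definition mutually_independent {I : finType} (D : {set I}) (X : I -> T -> R) :=
  forall (J : {set I}) (B : I -> set R), J \subset D ->
    (forall i, measurable (B i)) ->
    P (\bigcap_(i in [set` J]) (X i @^-1` B i))
    = (\prod_(i in J) P (X i @^-1` B i))%E.

Definition independent_sigma (G H : set (set T)) :=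
  forall B C, G B -> H C -> P (B `&` C) = (P B * P C)%E.

(* The sigma-algebra generated by the entries of a random matrix. *)
Definition sigma_mx {m n : nat} (X : T -> 'M[R]_(m, n)) : set (set T) :=
  <<s \bigcup_(ij in [set: 'I_m * 'I_n])
        preimage_set_system setT (fun w => X w ij.1 ij.2) measurable >>.

(* Versions of E[X | G] for a [0, +oo]-valued X, not assumed integrable. *)
Definition cond_exp_version (G : set (set T)) (X : T -> \bar R) :
    set (T -> \bar R) :=
  [set Y : T -> \bar R | [/\ forall w, (0 <= Y w)%E,
      forall B : set (\bar R), measurable B -> G (Y @^-1` B) &
      forall B, G B -> (\int[P]_(w in B) Y w = \int[P]_(w in B) X w)%E]].

(* A chosen version of E[X | G]; versions agree almost surely. The default
   value +oo makes a finite upper bound on cond_exp entail that a version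
   exists. *)
Definition cond_exp (G : set (set T)) (X : T -> \bar R) : T -> \bar R :=
  xget (cst +oo%E) (cond_exp_version G X).

Definition cond_prob (G : set (set T)) (E : set T) : T -> \bar R :=
  cond_exp G (fun w => (\1_E w)%:E).

End Probability.

Section GFOM.
Context {R : realType} {n : nat}.

(* A row-separate map R^{n x [0:s-1]} -> R^n, from its components. *)
Definition row_sep {s : nat} (H : 'I_n -> 'rV[R]_s -> R) (M : 'M[R]_(n, s)) :
    'cV[R]_n :=
  \col_l H l (row l M).

Variables (A : 'M[R]_n) (F G : forall s : nat, 'I_n -> 'rV[R]_s -> R).
Variable z0 : 'cV[R]_n.

(* The list z^(0), ..., z^(t); F 0 and G 0 are never used. *)
Fixpoint gfom_seq (t : nat) : seq 'cV[R]_n :=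
  if t is s.+1 then
    let h := gfom_seq s in
    let M := \matrix_(l < n, r < s.+1) (nth 0 h r) l 0 in
    rcons h (A *m row_sep (@F s.+1) M + row_sep (@G s.+1) M)
  else [:: z0].

Definition gfom (t : nat) : 'cV[R]_n := nth 0 (gfom_seq t) t.

Lemma size_gfom_seq t : size (gfom_seq t) = t.+1.
Proof. by elim: t => //= t IH; rewrite size_rcons IH. Qed.

Lemma nth_gfom_seq t r : (r <= t)%N -> nth 0 (gfom_seq t) r = gfom r.
Proof.
elim: t => [|t IH]; first by rewrite leqn0 => /eqP ->.
rewrite leq_eqVlt => /predU1P[-> //|]; rewrite ltnS => rt.
by rewrite /= nth_rcons size_gfom_seq ltnS rt IH.
Qed.

Lemma gfom0 : gfom 0 = z0.
Proof. by []. Qed.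

Lemma gfomS t (M := \matrix_(l < n, r < t.+1) gfom r l 0) :
  gfom t.+1 = A *m row_sep (@F t.+1) M + row_sep (@G t.+1) M.
Proof.
rewrite {1}/gfom /= nth_rcons size_gfom_seq ltnn eqxx.
suff -> : \matrix_(l < n, r < t.+1) (nth 0 (gfom_seq t) r) l 0 = M by [].
by apply/matrixP => l r; rewrite !mxE nth_gfom_seq // -ltnS.
Qed.

End GFOM.

Definition leave_out {R : realType} {n : nat} (S : {set 'I_n}) (A : 'M[R]_n) :
    'M[R]_n :=
  \matrix_(i, j) (if (i \notin S) && (j \notin S) then A i j else 0).

(* Main.v *)
Require Import Defs.
From HB Require Import structures.
From mathcomp Require Import all_boot all_order all_algebra.
From mathcomp Require Import all_classical all_reals all_analysis measurable_realfun.
From mathcomp Require Import ring lra.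
Import Order.TTheory GRing.Theory Num.Theory.
Import numFieldNormedType.Exports.
Local Open Scope classical_set_scope.
Local Open Scope ring_scope.
Set Implicit Arguments.
Unset Strict Implicit.
Unset Printing Implicit Defensive.

(** Condition on [z^(0)], which is independent of [A]: by the freezing lemma
    [freezing_version] it may be treated as a constant vector, so that all three
    claims reduce to estimates for a deterministic initialization.

    The first claim is proved pathwise on a good event.  Put
    [M = 512 K (1 + sqrt (x / n))].  The good event asks for two things.
    First, [A] has operator norm at most [M] ([opnorm_tail]); this is a union
    bound over a lattice net of [exp(O(n))] points in the ball, each bilinear form
    [u^T A v] being a sub-Gaussian linear combination of the independent entries of
    the upper triangle.  Secondly, for each [i] in [S] and each step [s], the row
    product [sum_(j notin S) A i j * v_s j], where [v_s] is [F_s] applied to the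
    leave-out iterates, is of order [K sqrt x |v_s| / sqrt n] ([row_tail]).  The
    point of leaving [S] out is that [v_s] only depends on entries outside
    the rows and columns of [S], hence is independent of the row [A i].  Both
    estimates are instances of one Chernoff bound, [subgaussian_tail], for linear
    combinations whose coefficients may be random but are independent of the
    variables that they multiply.

    On the good event the difference of the two recursions satisfies a linear
    recursion with factor [3 M L] whose source at step [s] is
    [(A - A_(-S)) v_s].  This source splits into the columns of [S], where [v_s] is
    controlled because left-out coordinates evolve deterministically, and into the
    rows of [S], controlled by the second half of the good event
    ([leave_out_source]).  Summing up gives the bound [leave_out_pathwise] with the
    rate [6 M L = 3072 K L (1 + sqrt (x / n))].

    The second claim is the first one for [S = {k}], since the coordinate [k] of
    the leave-out iterate is then deterministic.  The moment bounds integrate this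
    tail over the levels [b (1 + sqrt m)^(t+2)], [m = 0, 1, 2, ...]
    ([moment_of_tail]); for the supremum, a union bound over [n] coordinates is
    absorbed by the shift [x = m + c ln n]. *)

(** * Integration over independent variables *)

Section Independence.
Context {d d1 d2 : measure_display} {T : measurableType d}
  {T1 : measurableType d1} {T2 : measurableType d2} {R : realType}.
Variable P : probability T R.
Variables (U : T -> T1) (V : T -> T2).
Hypotheses (mU : measurable_fun setT U) (mV : measurable_fun setT V).
Variable f : T1 * T2 -> \bar R.
Hypotheses (mf : measurable_fun setT f) (f0 : forall z, (0 <= f z)%E).

Let U' : {mfun T >-> T1} := HB.pack U (isMeasurableFun.Build _ _ _ _ _ mU).
Let V' : {mfun T >-> T2} := HB.pack V (isMeasurableFun.Build _ _ _ _ _ mV).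

Let sectionE y :
  (\int[distribution P U']_x f (x, y) = \int[P]_w f (U w, y))%E.
Proof.
rewrite ge0_integral_pushforward ?preimage_setT//.
exact: measurableT_comp mf (pair2_measurable _).
Qed.

Lemma measurable_section_integral :
  measurable_fun setT (fun y => \int[P]_w f (U w, y))%E.
Proof.
apply: eq_measurable_fun (measurable_fun_fubini_tonelli_G
  (m1 := distribution P U') f mf f0) => y _.
exact: sectionE.
Qed.

Hypothesis indepUV : forall B C, measurable B -> measurable C ->
  P (U @^-1` B `&` V @^-1` C) = (P (U @^-1` B) * P (V @^-1` C))%E.

(** Independence says that the law of [(U, V)] is the product of the laws of
    [U] and [V], so Tonelli applies to that law. *)
Lemma integral_indep :
  (\int[P]_w f (U w, V w) = \int[P]_w \int[P]_w' f (U w', V w))%E.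
Proof.
have mUV : measurable_fun setT (fun w => (U w, V w)).
  exact: measurable_fun_pair.
pose UV : {mfun T >-> (T1 * T2)%type} :=
  HB.pack (fun w => (U w, V w)) (isMeasurableFun.Build _ _ _ _ _ mUV).
transitivity (\int[distribution P UV]_z f z)%E.
  by rewrite ge0_integral_pushforward ?preimage_setT.
rewrite (eq_measure_integral (distribution P U' \x distribution P V')%E);
  last first.
  by move=> A mA _; apply/esym/product_measure_unique => // B C mB mC /=;
    exact: indepUV.
rewrite fubini_tonelli2//.
under eq_integral do rewrite /fubini_G sectionE.
rewrite (ge0_integral_pushforward mV) ?preimage_setT//.
  exact: measurable_section_integral.
by move=> y _; exact: integral_ge0.
Qed.

End Independence.

(** * Independent families *)

Section SubFamily.
Context {d : measure_display} {T : measurableType d} {R : realType}.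
Context {I : finType}.
Variable P : probability T R.
Variables (D : {set I}) (X : I -> T -> R).
Hypothesis mX : forall i, measurable_fun setT (X i).

Definition family_gen (E : {set I}) : set (set T) :=
  \bigcup_(e in [set` E]) preimage_set_system setT (X e) measurable.

Lemma family_gen_measurable (E : {set I}) :
  <<s family_gen E >> `<=` (@measurable _ T).
Proof.
apply: smallest_sub; first exact: sigma_algebra_measurable.
by move=> A [e _] [B mB <-]; exact: mX.
Qed.

Lemma measurable_family_member (E : {set I}) (e : I) : e \in E ->
  measurable_fun setT (X e : g_sigma_algebraType (family_gen E) -> R).
Proof.
move=> eE _ B mB; apply: sub_sigma_algebra.
by exists e => //; exists B.
Qed.

Lemma measurable_family_id (E : {set I}) :
  measurable_fun setT (fun w : T => (w : g_sigma_algebraType (family_gen E))).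
Proof.
by move=> _ B mB; rewrite setTI; exact: (family_gen_measurable (E := E)).
Qed.

Lemma measurable_family_sub (E E' : {set I}) d' (T' : measurableType d')
    (f : T -> T') : E \subset E' ->
  measurable_fun setT (f : g_sigma_algebraType (family_gen E) -> T') ->
  measurable_fun setT (f : g_sigma_algebraType (family_gen E') -> T').
Proof.
move=> EE' mf _ B mB.
have : <<s family_gen E >> (setT `&` f @^-1` B) by exact: mf.
apply: smallest_sub; first exact: smallest_sigma_algebra.
apply: subset_trans (@sub_sigma_algebra _ setT (family_gen E')).
by move=> A [e /= eE AB]; exists e => //; apply: (fintype.subsetP EE').
Qed.

Lemma measurable_family_T (E : {set I}) d' (T' : measurableType d')
    (f : T -> T') :
  measurable_fun setT (f : g_sigma_algebraType (family_gen E) -> T') ->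
  measurable_fun setT f.
Proof.
by move=> mf; apply: (measurableT_comp mf); exact: measurable_family_id.
Qed.

Hypothesis indX : mutually_independent P D X.

Let cyl (E : {set I}) : set (set T) :=
  [set C | exists2 B : I -> set R, (forall i, measurable (B i)) &
    C = \bigcap_(i in [set` E]) (X i @^-1` B i)].

(** For a fixed event [X j @^-1` B], both sides are finite measures in [C].
    Mutual independence makes them agree on the cylinders over [E], which form
    a pi-system generating the sigma-algebra of the subfamily. *)
Lemma indep_member_rest (j : I) (E : {set I}) (B : set R) (C : set T) :
  j \in D -> E \subset D -> j \notin E -> measurable B ->
  <<s family_gen E >> C ->
  P (X j @^-1` B `&` C) = (P (X j @^-1` B) * P C)%E.
Proof.
move=> jD ED jE mB mC.
have mA : measurable (X j @^-1` B).
  by rewrite -[X in measurable X]setTI; exact: mX.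
have cylC : <<s cyl E >> C.
  move: mC; apply: smallest_sub; first exact: smallest_sigma_algebra.
  apply: subset_trans (@sub_sigma_algebra _ setT (cyl E)).
  move=> A [e /= eE] [B' mB' <-].
  exists (fun i => if i == e then B' else setT).
    by move=> i; case: ifP.
  apply/seteqP; split => [w [_ Xw] i iE /=|w /(_ e eE)] /=.
    by case: ifP => // /eqP ->.
  by rewrite eqxx.
pose r := fine (P (X j @^-1` B)).
have rE : (r%:E = P (X j @^-1` B))%E by rewrite /r fineK ?fin_num_measure.
have r0 : 0 <= r by rewrite fine_ge0.
pose m1 : {measure set T -> \bar R} := mrestr P mA.
pose m2 : {measure set T -> \bar R} := mscale (NngNum r0) P.
rewrite setIC -rE.
apply: (@g_sigma_algebra_measure_unique _ _ _ (cyl E) _ (fun _ => setT) _ _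
  m1 m2 _ _ _ _ cylC).
- move=> _ [B' mB' ->]; apply: fin_bigcap_measurable => // i _.
  by rewrite -[X in measurable X]setTI; exact: mX.
- move=> n; exists (fun=> setT) => //; apply/seteqP; split => //.
- by apply/seteqP; split => // w _; exists 0%N.
- move=> _ _ [B1 mB1 ->] [B2 mB2 ->].
  exists (fun i => B1 i `&` B2 i); first by move=> i; exact: measurableI.
  apply/seteqP; split => [w [w1 w2] i iE|w w12].
    by split; [exact: w1|exact: w2].
  by split=> i iE; have [] := w12 i iE.
- move=> _ [B' mB' ->].
  rewrite /m1 /m2 /= /mscale /= rE /mrestr setIC.
  rewrite [X in (_ = _ * X)%E]indX //.
  pose B'' i := if i == j then B else B' i.
  transitivity (P (\bigcap_(i in [set` (j |: E)%SET]) (X i @^-1` B'' i))).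
    congr (P _); apply/seteqP; split => [w [w1 w2] i /= |w wE].
      rewrite !inE /B'' => /orP[/eqP ->|iE]; first by rewrite eqxx.
      by case: eqP => [->//|_]; exact: w2.
    split; first by have := wE j; rewrite /= !inE /B'' eqxx; exact.
    move=> i /= iE; have := wE i; rewrite /= !inE iE orbT /B''.
    case: eqP => [ij|_]; last exact.
    by move: jE; rewrite -ij iE.
  rewrite indX.
  + rewrite big_setU1//= /B'' eqxx; congr (_ * _)%E.
    apply: eq_bigr => i iE; case: eqP => // ij.
    by move: jE; rewrite -ij iE.
  + by rewrite finset.subUset finset.sub1set jD.
  + by move=> i; rewrite /B''; case: ifP.
- by move=> k; rewrite /= /m1 /mrestr ltey_eq fin_num_measure // setTI.
Qed.

End SubFamily.

(** * Sub-Gaussian linear combinations *)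

Section SubGaussian.
Context {d : measure_display} {T : measurableType d} {R : realType}.
Variable P : probability T R.

Lemma markov_ge (g : T -> R) (a : R) : 0 <= a -> measurable_fun setT g ->
  (forall w, 0 <= g w) ->
  (a%:E * P [set w | (a <= g w)%R] <= \int[P]_w (g w)%:E)%E.
Proof.
move=> a0 mg g0.
have mA : measurable [set w | a <= g w].
  by rewrite -[X in measurable X]setTI; apply: measurable_fun_le.
rewrite -integral_cst//.
apply: (@le_trans _ _ (\int[P]_(w in [set w | (a <= g w)%R]) (g w)%:E)%E).
  apply: ge0_le_integral => //.
  - by apply/measurable_EFinP; exact: measurable_funTS.
apply: ge0_subset_integral => //.
- exact/measurable_EFinP.
- by move=> w _; rewrite lee_fin.
Qed.

(** [k] is the variance proxy in the normalization [exp (k l^2)], without the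
    customary factor one half. *)
Definition subgaussian (k : R) (Y : T -> R) : Prop :=
  forall l, (\int[P]_w (expR (l * Y w))%:E <= (expR (k * l ^+ 2))%:E)%E.

Context {I : finType}.
Variables (D : {set I}) (X : I -> T -> R).
Hypothesis mX : forall i, measurable_fun setT (X i).
Hypothesis indX : mutually_independent P D X.
Variable k : R.
Hypothesis subX : forall i, i \in D -> subgaussian k (X i).

(** Integrating [X j] first, with the rest of the family frozen, produces a
    factor at most [expR (k * b^2)], which the compensator cancels exactly. *)
Lemma subgaussian_pull_out (j : I) (E : {set I}) (h b : T -> R) :
  j \in D -> E \subset D -> j \notin E ->
  measurable_fun setT (h : g_sigma_algebraType (family_gen X E) -> R) ->
  measurable_fun setT (b : g_sigma_algebraType (family_gen X E) -> R) ->
  (forall w, 0 <= h w) ->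
  (\int[P]_w (h w * expR (b w * X j w - k * b w ^+ 2))%:E
   <= \int[P]_w (h w)%:E)%E.
Proof.
move=> jD ED jE mh mb h0.
pose TE := g_sigma_algebraType (family_gen X E).
pose f (z : R * TE) : \bar R :=
  (h z.2 * expR (b z.2 * z.1 - k * b z.2 ^+ 2))%:E.
have mb2 : measurable_fun setT (fun z : R * TE => b z.2).
  exact: measurableT_comp mb _.
have mf : measurable_fun setT f.
  apply/measurable_EFinP/measurable_funM.
    exact: measurableT_comp mh _.
  apply: measurableT_comp => //; apply: measurable_funB.
    exact: measurable_funM.
  by apply: measurable_funM => //; exact: measurable_funX.
have f0 z : (0 <= f z)%E by rewrite lee_fin mulr_ge0 ?expR_ge0.
rewrite (integral_indep (mX j) (measurable_family_id mX (E := E)) mf f0).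
  apply: ge0_le_integral => //.
  - by move=> w _; exact: integral_ge0.
  - apply: (measurable_family_T mX (E := E)).
    exact: (measurable_section_integral P (mX j) mf f0).
  - by apply/measurable_EFinP; exact: (measurable_family_T mX mh).
  - move=> w _; rewrite /f /=.
    under eq_integral do rewrite expRD mulrCA EFinM muleC.
    rewrite ge0_integralZl_EFin//; last 2 first.
    + by apply/measurable_EFinP/measurableT_comp => //; exact: measurable_funM.
    + by rewrite mulr_ge0// expR_ge0.
    + apply: (@le_trans _ _
        ((h w * expR (- (k * b w ^+ 2)))%:E * (expR (k * b w ^+ 2))%:E)%E).
        by apply: lee_wpmul2l; [rewrite lee_fin mulr_ge0 ?expR_ge0|exact: subX].
      by rewrite -EFinM -mulrA -expRD addNr expR0 mulr1.
by move=> B C mB mC; exact: (indep_member_rest mX indX jD ED jE mB mC).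
Qed.

End SubGaussian.

Lemma measurable_sum_seq d (T : measurableType d) (R : realType) (I : eqType)
    (s : seq I) (h : I -> T -> R) :
  (forall i, i \in s -> measurable_fun setT (h i)) ->
  measurable_fun setT (fun x => \sum_(i <- s) h i x).
Proof.
elim: s => [_|i s IH ms].
  by under eq_fun do rewrite big_nil; exact: measurable_cst.
under eq_fun do rewrite big_cons.
apply: measurable_funD; first by apply: ms; rewrite mem_head.
by apply: IH => l ls; apply: ms; rewrite inE ls orbT.
Qed.

Section MartingaleTail.
Context {d : measure_display} {T : measurableType d} {R : realType}.
Variable P : probability T R.
Context {I : finType}.
Variables (D J : {set I}) (X : I -> T -> R) (k : R).
Hypothesis mX : forall i, measurable_fun setT (X i).
Hypothesis indX : mutually_independent P D X.
Hypothesis subX : forall i, i \in D -> subgaussian P k (X i).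
Hypothesis JD : J \subset D.

(** The variables indexed by [J] are integrated out one at a time.  When [X j]
    is removed, its coefficient and all the remaining terms are functions of
    the family without [j]; this is why random coefficients are allowed as long
    as they do not involve the variables of [J]. *)
Lemma exp_linear_le1 (b : I -> T -> R) :
  (forall j, j \in J ->
     measurable_fun setT (b j : g_sigma_algebraType (family_gen X (D :\: J)) -> R)) ->
  (\int[P]_w (expR (\sum_(j in J) (b j w * X j w - k * b j w ^+ 2)))%:E <= 1)%E.
Proof.
move=> mb.
under eq_integral do rewrite -big_enum.
have : {subset enum J <= J} by move=> j; rewrite mem_enum.
have : uniq (enum J) by exact: enum_uniq.
elim: (enum J) => [_ _|j s IH /= /andP[js us] sJ].
  under eq_integral do rewrite big_nil expR0.
  by rewrite integral_cst// mul1e probability_le1.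
have {}IH := IH us (fun i si => sJ i (mem_behead (s := j :: s) si)).
have jJ : j \in J by apply: sJ; rewrite mem_head.
have jD : j \in D by apply: (fintype.subsetP JD).
under eq_integral do rewrite big_cons addrC expRD.
apply: le_trans IH.
have DE : D :\ j \subset D by rewrite subD1set.
have DJ : D :\: J \subset D :\ j.
  apply/fintype.subsetP => i; rewrite !inE => /andP[iJ ->]; rewrite andbT.
  by apply: contraNneq iJ => ->.
have mbj i : i \in J -> measurable_fun setT
    (b i : g_sigma_algebraType (family_gen X (D :\ j)) -> R).
  by move=> iJ; exact: (measurable_family_sub DJ (mb i iJ)).
apply: (subgaussian_pull_out mX indX subX jD DE).
- by rewrite !inE eqxx.
- apply: measurableT_comp => //.
  apply: measurable_sum_seq => i si.
  have iJ : i \in J by apply: sJ; rewrite inE si orbT.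
  apply: measurable_funB.
    apply: measurable_funM; first exact: mbj.
    apply: measurable_family_member; rewrite !inE (fintype.subsetP JD)// andbT.
    by apply: contraNneq js => <-.
  by apply: measurable_funM => //; apply: measurable_funX; exact: mbj.
- exact: mbj.
- by move=> w; exact: expR_ge0.
Qed.

(** Chernoff's bound with the optimal parameter [l = tau / (2 k beta)].  The
    random compensator is replaced by its deterministic upper bound
    [k l^2 beta] only after taking expectations. *)
Lemma subgaussian_tail (b : I -> T -> R) (beta tau : R) :
  0 < k -> 0 < beta -> 0 <= tau ->
  (forall j, j \in J ->
     measurable_fun setT (b j : g_sigma_algebraType (family_gen X (D :\: J)) -> R)) ->
  (forall w, \sum_(j in J) b j w ^+ 2 <= beta) ->
  (P [set w | (tau <= \sum_(j in J) b j w * X j w)%R]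
   <= (expR (- (tau ^+ 2 / (4 * k * beta))))%:E)%E.
Proof.
move=> k0 beta0 tau0 mb bbeta.
pose l := tau / (2 * k * beta).
have l0 : 0 <= l by rewrite divr_ge0// !mulr_ge0// ltW.
set c := tau ^+ 2 / (4 * k * beta).
pose g w := \sum_(j in J) ((l * b j w) * X j w - k * (l * b j w) ^+ 2).
have mbT j : j \in J -> measurable_fun setT (b j).
  by move=> jJ; apply: (measurable_family_T mX (mb j jJ)).
have mg : measurable_fun setT g.
  rewrite /g; under eq_fun do rewrite -big_enum.
  apply: measurable_sum_seq => j; rewrite mem_enum => jJ.
  apply: measurable_funB; first by do 2 apply: measurable_funM => //; exact: mbT.
  apply: measurable_funM => //; apply: measurable_funX.
  by apply: measurable_funM => //; exact: mbT.
have intg : (\int[P]_w (expR (g w))%:E <= 1)%E.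
  apply: (exp_linear_le1 (b := fun j w => l * b j w)) => j jJ.
  by apply: measurable_funM => //; exact: mb.
have mS : measurable_fun setT (fun w => \sum_(j in J) b j w * X j w).
  under eq_fun do rewrite -big_enum.
  apply: measurable_sum_seq => j; rewrite mem_enum => jJ.
  by apply: measurable_funM => //; exact: mbT.
have sub : [set w | tau <= \sum_(j in J) b j w * X j w]
    `<=` [set w | expR c <= expR (g w)].
  move=> w /= tauw; rewrite ler_expR /g sumrB.
  have -> : \sum_(j in J) l * b j w * X j w = l * \sum_(j in J) b j w * X j w.
    by rewrite mulr_sumr; apply: eq_bigr => j _; rewrite mulrA.
  have -> : \sum_(j in J) k * (l * b j w) ^+ 2 =
      k * l ^+ 2 * \sum_(j in J) b j w ^+ 2.
    by rewrite mulr_sumr; apply: eq_bigr => j _; rewrite exprMn mulrA.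
  have -> : c = l * tau - k * l ^+ 2 * beta.
    by rewrite /c /l; field; rewrite !gt_eqF.
  apply: lerB; first exact: ler_wpM2l.
  by apply: ler_wpM2l; rewrite // mulr_ge0 ?sqr_ge0// ltW.
have me : measurable_fun setT (fun w => expR (g w)) by exact: measurableT_comp.
have := markov_ge P (expR_ge0 c) me (fun w => expR_ge0 (g w)).
move=> /le_trans/(_ intg) mk.
apply: (@le_trans _ _ (P [set w | (expR c <= expR (g w))%R])).
  apply: le_measure => //; rewrite inE.
    by rewrite -[X in measurable X]setTI; apply: measurable_fun_le.
  by rewrite -[X in measurable X]setTI; apply: measurable_fun_le.
by rewrite expRN -[leRHS]mul1e lee_pdivlMr ?expR_gt0// muleC.
Qed.

End MartingaleTail.

(** * Centred variables with finite psi_2 norm *)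

(** From [1 - x / 2 <= expR (- (x / 2))], squared and inverted; the remaining
    polynomial inequality holds up to [x = 1]. *)
Lemma expR_le_quad (R : realType) (x : R) :
  x <= 1 -> expR x <= 1 + x + 2 * x ^+ 2.
Proof.
move=> x1.
have h : 0 < 1 - x / 2 by lra.
have e1 : 1 - x / 2 <= expR (- (x / 2)) by exact: expR_ge1Dx.
have e2 : (1 - x / 2) ^+ 2 * expR x <= 1.
  have -> : expR x = expR (x / 2) ^+ 2 by rewrite -expRM_natl; congr expR; field.
  rewrite -exprMn expr_le1//; last by rewrite mulr_ge0 ?expR_ge0// ltW.
  by rewrite -ler_pdivlMr ?expR_gt0// mul1r -expRN.
have h2 : 0 < (1 - x / 2) ^+ 2 by rewrite exprn_gt0.
rewrite -(ler_pM2l h2) (le_trans e2)//.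
have -> : (1 - x / 2) ^+ 2 * (1 + x + 2 * x ^+ 2) =
   1 + x ^+ 2 * ((1 - x) * (5 / 4 - x / 2)) by field.
by rewrite lerDl mulr_ge0 ?sqr_ge0// mulr_ge0; lra.
Qed.

(** The linear term integrates to zero for a centred variable, so that only a
    square exponential is left, which is what the psi_2 norm controls. *)
Lemma expR_le_id_gauss (R : realType) (x : R) :
  expR x <= x + expR (2 * x ^+ 2).
Proof.
have [x1|x1] := leP x 1.
  apply: le_trans (expR_le_quad x1) _.
  have := expR_ge1Dx (2 * x ^+ 2); lra.
apply: (@le_trans _ _ (expR (2 * x ^+ 2))); last by rewrite lerDr; lra.
by rewrite ler_expR; nra.
Qed.

(** Convexity of the exponential between [0] and [y], by the two tangent
    inequalities at [th * y].  It replaces the Jensen inequality for the power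
    [th] of [expR y]. *)
Lemma expR_convex_chord (R : realType) (th y : R) : 0 <= th <= 1 ->
  expR (th * y) <= 1 - th + th * expR y.
Proof.
move=> /andP[th0 th1].
set E := expR (th * y).
have E0 : 0 < E by exact: expR_gt0.
have h1 : E * (1 + (1 - th) * y) <= expR y.
  have -> : expR y = E * expR ((1 - th) * y) by rewrite -expRD; congr expR; ring.
  by rewrite ler_pM2l// expR_ge1Dx.
have h2 : E * (1 - th * y) <= 1.
  by rewrite -ler_pdivlMl// mulr1 -expRN expR_ge1Dx.
nra.
Qed.

Section PsiTwo.
Context {d : measure_display} {T : measurableType d} {R : realType}.
Variable P : probability T R.

(** Two regimes for [th = 8 K^2 l^2].  For small [th] the exponential is
    compared with [l X + expR (th (X / 2K)^2)] and the mean of [X] vanishes; for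
    large [th] Young's inequality [l X <= th / 4 + (X / 2K)^2 / 2] suffices, as
    the loss of a constant factor is absorbed by [expR th]. *)
Lemma psi2_subgaussian (X : T -> R) (K : R) : 0 < K ->
  measurable_fun setT X -> ('E_P[X] = 0)%E -> (psi2_norm P X <= K%:E)%E ->
  subgaussian P (8 * K ^+ 2) X.
Proof.
move=> K0 mX EX0 psiK l.
(* The infimum defining the norm need not be attained at [K]. *)
pose K' := 2 * K.
have K'0 : 0 < K' by rewrite mulr_gt0.
pose V w := expR ((X w / K') ^+ 2).
have mV : measurable_fun setT V.
  apply: measurableT_comp => //; apply: measurable_funX.
  exact: measurable_funM.
have intV : (\int[P]_w (V w)%:E <= 2%:E)%E.
  have : (psi2_norm P X < K'%:E)%E.
    by apply: le_lt_trans psiK _; rewrite lte_fin /K'; lra.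
  move=> /ereal_inf_lt[_ [C [C0 EC] <-]]; rewrite lte_fin => CK.
  apply: le_trans EC; rewrite unlock.
  apply: ge0_le_integral => //.
  - by move=> w _; rewrite lee_fin expR_ge0.
  - exact/measurable_EFinP.
  - apply/measurable_EFinP/measurableT_comp => //; apply: measurable_funX.
    exact: measurable_funM.
  - move=> w _; rewrite lee_fin ler_expR !exprMn; apply: ler_wpM2l.
      exact: sqr_ge0.
    rewrite lerXn2r ?nnegrE ?invr_ge0 ?ltW// ltf_pV2//.
have iV : P.-integrable setT (EFin \o V).
  apply/integrableP; split; first exact/measurable_EFinP.
  under eq_integral do rewrite /= ger0_norm ?expR_ge0//.
  exact: le_lt_trans intV (ltry _).
have iX : P.-integrable setT (EFin \o X).
  apply: (le_integrable _ _ _ (integrableZl _ K' iV)) => //.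
    exact/measurable_EFinP.
  move=> w _ /=; rewrite lee_fin (@ger0_norm _ (K' * V w)); last first.
    by rewrite mulr_ge0 ?expR_ge0// ltW.
  have -> : X w = K' * (X w / K') by field; rewrite gt_eqF.
  rewrite normrM gtr0_norm// /V ler_pM2l//.
  set u := X w / K'.
  have := expR_ge1Dx (u ^+ 2).
  by rewrite -(real_normK (num_real u)) => h; apply: le_trans h; nra.
have affine a b c : 0 <= c ->
  (forall w, expR (l * X w) <= a * X w + (b + c * V w)) ->
  (\int[P]_w (expR (l * X w))%:E <= (b + 2 * c)%:E)%E.
  move=> c0 h.
  apply: (@le_trans _ _ (\int[P]_w (a * X w + (b + c * V w))%:E)%E).
    apply: ge0_le_integral => //.
    - by apply/measurable_EFinP/measurableT_comp => //; exact: measurable_funM.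
    - apply/measurable_EFinP/measurable_funD; first exact: measurable_funM.
      by apply: measurable_funD => //; exact: measurable_funM.
    - by move=> w _; rewrite lee_fin.
  under eq_integral do rewrite EFinD.
  have icV : P.-integrable setT (fun w => (c * V w)%:E).
    by have := integrableZl measurableT c iV.
  have ib : P.-integrable setT (fun w => (b + c * V w)%:E).
    have := integrableD measurableT (finite_measure_integrable_cst P b measurableT) icV.
    exact.
  rewrite integralD//; last by have := integrableZl measurableT a iX.
  under eq_integral do rewrite EFinM.
  rewrite integralZl//.
  move: EX0; rewrite unlock => ->; rewrite mule0 add0e.
  under eq_integral do rewrite EFinD.
  rewrite integralD//; last exact: finite_measure_integrable_cst.
  rewrite integral_cst// [X in (b%:E * X + _)%E](_ : _ = 1%E); last exact: probability_setT.
  rewrite mule1.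
  under eq_integral do rewrite EFinM.
  rewrite integralZl// EFinD leeD2l// EFinM muleC.
  by apply: lee_wpmul2r; rewrite ?lee_fin.
set th := 8 * K ^+ 2 * l ^+ 2.
have thE u : 2 * (l * (K' * u)) ^+ 2 = th * u ^+ 2 by rewrite /th /K'; ring.
have th0 : 0 <= th by rewrite /th -mulrA -exprMn mulr_ge0 ?sqr_ge0.
have XE w : X w = K' * (X w / K') by field; rewrite gt_eqF.
have [th1|th1] := leP th 1.
  apply: le_trans (affine l (1 - th) th _ _) _ => //.
    move=> w; apply: le_trans (expR_le_id_gauss _) _; rewrite lerD2l.
    rewrite {1}(XE w) thE.
    by apply: expR_convex_chord; rewrite th0.
  rewrite lee_fin; apply: le_trans (expR_ge1Dx _); lra.
pose q := expR (th / 4).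
apply: le_trans (affine 0 (q / 2) (q / 2) _ _) _.
- by rewrite divr_ge0// expR_ge0.
- move=> w; rewrite mul0r add0r.
  have -> : q / 2 + q / 2 * V w = q * (1 - 1/2 + 1/2 * V w) by field.
  apply: le_trans (_ : q * expR (1 / 2 * (X w / K') ^+ 2) <= _); last first.
    rewrite ler_pM2l ?expR_gt0//; apply: expR_convex_chord; lra.
  rewrite -expRD ler_expR {1}(XE w).
  set u := X w / K'.
  have -> : th / 4 = (l * K') ^+ 2 / 2 by rewrite /th /K'; field.
  by have := sqr_ge0 (l * K' - u); nra.
- rewrite lee_fin.
  have -> : q / 2 + 2 * (q / 2) = q * (3 / 2) by field.
  have -> : expR th = q * expR (3 / 4 * th).
    by rewrite -expRD; congr expR; field.
  rewrite ler_pM2l ?expR_gt0//.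
  by apply: le_trans (expR_ge1Dx _); lra.
Qed.

End PsiTwo.

(** * The Euclidean norm *)

Section EuclideanNorm.
Context {R : realType}.

(** The sum of the squares [(G f_i - C g_i)^2] equals [G (F G - C^2)]. *)
Lemma cauchy_schwarz_sum (I : finType) (f g : I -> R) :
  (\sum_i f i * g i) ^+ 2 <= (\sum_i f i ^+ 2) * (\sum_i g i ^+ 2).
Proof.
set C := \sum_i f i * g i; set F := \sum_i f i ^+ 2; set G := \sum_i g i ^+ 2.
have G0 : 0 <= G by apply: sumr_ge0 => i _; exact: sqr_ge0.
have [G00|Gn0] := eqVneq G 0.
  have g0 i : g i = 0.
    have := psumr_eq0P (P := predT) (F := fun i => g i ^+ 2)
      (fun i _ => sqr_ge0 _) G00.
    by move=> /(_ i isT)/eqP; rewrite sqrf_eq0 => /eqP.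
  rewrite G00 mulr0 /C big1 ?expr0n// => i _.
  by rewrite g0 mulr0.
have Gp : 0 < G by rewrite lt_def Gn0.
have : 0 <= \sum_i (G * f i - C * g i) ^+ 2.
  by apply: sumr_ge0 => i _; exact: sqr_ge0.
have -> : \sum_i (G * f i - C * g i) ^+ 2 = G * (F * G - C ^+ 2).
  have expand a b : \sum_i (a * f i - b * g i) ^+ 2 =
      a ^+ 2 * F - 2 * a * b * C + b ^+ 2 * G.
    rewrite /F /G /C !mulr_sumr -sumrB -big_split/=.
    by apply: eq_bigr => i _; ring.
  by rewrite expand; ring.
by rewrite pmulr_rge0// subr_ge0.
Qed.

Lemma norm2_pair m n (v : 'M[R]_(m, n)) :
  norm2 v = Num.sqrt (\sum_(p : 'I_m * 'I_n) v p.1 p.2 ^+ 2).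
Proof. by rewrite /norm2 pair_big. Qed.

Lemma norm2_ge0 m n (v : 'M[R]_(m, n)) : 0 <= norm2 v.
Proof. exact: sqrtr_ge0. Qed.

Lemma sqr_norm2 m n (v : 'M[R]_(m, n)) :
  norm2 v ^+ 2 = \sum_i \sum_j v i j ^+ 2.
Proof.
by rewrite sqr_sqrtr//; do 2 apply: sumr_ge0 => ? _; exact: sqr_ge0.
Qed.

Lemma sqr_norm2_pair m n (v : 'M[R]_(m, n)) :
  norm2 v ^+ 2 = \sum_(p : 'I_m * 'I_n) v p.1 p.2 ^+ 2.
Proof.
by rewrite norm2_pair sqr_sqrtr//; apply: sumr_ge0 => p _; exact: sqr_ge0.
Qed.

Lemma sqr_norm2_col n (v : 'cV[R]_n) : norm2 v ^+ 2 = \sum_i v i 0 ^+ 2.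
Proof. by rewrite sqr_norm2; apply: eq_bigr => i _; rewrite big_ord1. Qed.

Lemma sqr_norm2_row n (v : 'rV[R]_n) : norm2 v ^+ 2 = \sum_i v 0 i ^+ 2.
Proof. by rewrite sqr_norm2 big_ord1. Qed.

Lemma norm2_le m n (v : 'M[R]_(m, n)) c : 0 <= c ->
  (norm2 v <= c) = (norm2 v ^+ 2 <= c ^+ 2).
Proof. by move=> c0; rewrite ler_pXn2r ?nnegrE ?norm2_ge0. Qed.

Lemma norm2Z m n a (v : 'M[R]_(m, n)) : norm2 (a *: v) = `|a| * norm2 v.
Proof.
rewrite !norm2_pair -sqrtr_sqr -sqrtrM ?sqr_ge0//; congr Num.sqrt.
by rewrite mulr_sumr; apply: eq_bigr => p _; rewrite mxE exprMn.
Qed.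

Lemma norm20 m n : norm2 (0 : 'M[R]_(m, n)) = 0.
Proof. by rewrite -(scale0r 0) norm2Z normr0 mul0r. Qed.

Lemma norm2N m n (v : 'M[R]_(m, n)) : norm2 (- v) = norm2 v.
Proof. by rewrite -scaleN1r norm2Z normrN1 mul1r. Qed.

Lemma norm2_eq0 m n (v : 'M[R]_(m, n)) : norm2 v = 0 -> v = 0.
Proof.
move=> v0; apply/matrixP => i j; rewrite mxE.
have : \sum_(p : 'I_m * 'I_n) v p.1 p.2 ^+ 2 = 0.
  by rewrite -sqr_norm2_pair v0 expr0n.
move=> /psumr_eq0P h; have := h (fun _ _ => sqr_ge0 _) (i, j) isT.
by move/eqP; rewrite sqrf_eq0 => /eqP.
Qed.

Lemma ler_norm2D m n (u v : 'M[R]_(m, n)) :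
  norm2 (u + v) <= norm2 u + norm2 v.
Proof.
have s0 (w : 'M[R]_(m, n)) : 0 <= \sum_(p : 'I_m * 'I_n) w p.1 p.2 ^+ 2.
  by apply: sumr_ge0 => p _; exact: sqr_ge0.
have cs : \sum_(p : 'I_m * 'I_n) u p.1 p.2 * v p.1 p.2 <= norm2 u * norm2 v.
  rewrite !norm2_pair -sqrtrM// (le_trans (ler_norm _))// -sqrtr_sqr.
  by rewrite ler_wsqrtr// cauchy_schwarz_sum.
rewrite norm2_le ?addr_ge0 ?norm2_ge0// sqrrD.
rewrite !sqr_norm2_pair.
have -> : \sum_p (u + v) p.1 p.2 ^+ 2 = \sum_(p : 'I_m * 'I_n) u p.1 p.2 ^+ 2
  + (\sum_(p : 'I_m * 'I_n) u p.1 p.2 * v p.1 p.2) *+ 2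
  + \sum_(p : 'I_m * 'I_n) v p.1 p.2 ^+ 2.
  rewrite -mulr_natl mulr_sumr -!big_split/=; apply: eq_bigr => p _.
  by rewrite mxE; ring.
by rewrite lerD2r lerD2l ler_pMn2r.
Qed.

Lemma ler_norm2B m n (u v : 'M[R]_(m, n)) :
  norm2 u <= norm2 v + norm2 (u - v).
Proof. by rewrite -{1}(subrK v u) addrC ler_norm2D. Qed.

Lemma norm2_entry m n (v : 'M[R]_(m, n)) i j : `|v i j| <= norm2 v.
Proof.
rewrite norm2_pair -sqrtr_sqr ler_wsqrtr// (bigD1 (i, j))//= lerDl.
by apply: sumr_ge0 => p _; exact: sqr_ge0.
Qed.

Lemma ler_norm2_sum m n (v : 'M[R]_(m, n)) :
  norm2 v <= \sum_j norm2 (col j v).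
Proof.
have s0 : 0 <= \sum_j norm2 (col j v) by apply: sumr_ge0 => j _; exact: norm2_ge0.
rewrite norm2_le// sqr_norm2 exchange_big/=.
have -> : \sum_j \sum_i v i j ^+ 2 = \sum_j norm2 (col j v) ^+ 2.
  apply: eq_bigr => j _; rewrite sqr_norm2_col.
  by apply: eq_bigr => i _; rewrite mxE.
rewrite expr2 mulr_suml ler_sum// => j _; rewrite expr2 ler_wpM2l ?norm2_ge0//.
rewrite (bigD1 j)//= lerDl.
by apply: sumr_ge0 => i _; exact: norm2_ge0.
Qed.

Lemma ler_norm2_abs n (v : 'cV[R]_n) : norm2 v <= \sum_i `|v i 0|.
Proof.
have s0 : 0 <= \sum_i `|v i 0| by apply: sumr_ge0.
rewrite norm2_le// sqr_norm2_col expr2 mulr_suml ler_sum// => i _.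
rewrite -real_normK ?num_real// expr2.
rewrite ler_wpM2l// (bigD1 i)//= lerDl.
by apply: sumr_ge0.
Qed.

Lemma mulmx_norm2 m n (A : 'M[R]_(m, n)) (v : 'cV[R]_n) :
  norm2 (A *m v) <= norm2 A * norm2 v.
Proof.
rewrite norm2_le ?mulr_ge0 ?norm2_ge0// exprMn sqr_norm2_col sqr_norm2 mulr_suml.
apply: ler_sum => i _; rewrite mxE sqr_norm2_col.
exact: (cauchy_schwarz_sum (fun j => A i j) (fun j => v j 0)).
Qed.

End EuclideanNorm.

(** * Operator norm through a lattice net *)

Section Net.
Context {R : realType}.
Variable n : nat.

Definition grid_dist (j : 'I_(6 * n).+1) : nat := `|j - 3 * n|%N.

(** The index [k i] encodes the integer [k i - 3n], and the mesh is
    [1 / (2 sqrt n)], so that rounding the [n] coordinates of a vector moves it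
    by at most one half. *)
Definition grid_point (k : {ffun 'I_n -> 'I_(6 * n).+1}) : 'cV[R]_n :=
  \col_i (((k i)%:R - (3 * n)%:R) / (2 * Num.sqrt n%:R)).

(** The first constraint keeps the cardinality at [exp(O(n))]; the second one
    bounds the variance of the bilinear forms on the net. *)
Definition net : {set {ffun 'I_n -> 'I_(6 * n).+1}} :=
  [set k : {ffun 'I_n -> 'I_(6 * n).+1} |
    (\sum_i grid_dist (k i) <= 3 * n)%N && (norm2 (grid_point k) <= 2)]%SET.

(** The full two-sided series sums to 3; the proof by induction needs the exact
    value of the missing tail on either side of [c]. *)
Lemma sum_half_pow_dist (c N : nat) :
  \sum_(0 <= j < N) (2^-1 : R) ^+ `|j - c|%N <= 3.
Proof.
suff : \sum_(0 <= j < N) (2^-1 : R) ^+ `|j - c|%N <=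
    if (N <= c)%N then (2^-1) ^+ (c - N) else 3 - 2 * (2^-1) ^+ (N - c).
  move/le_trans; apply; case: ifP => _.
    apply: (@le_trans _ _ 1); last by lra.
    by rewrite exprn_ile1// ?invr_ge0//; lra.
  by rewrite gerBl mulr_ge0// exprn_ge0// invr_ge0.
elim: N => [|N IH].
  by rewrite big_geq//= exprn_ge0// invr_ge0.
rewrite big_nat_recr//=; have [Nc|cN] := ltnP N c.
  rewrite (ltnW Nc) in IH.
  have -> : `|N - c|%N = (c - N)%N by rewrite distnC distnEl// ltnW.
  apply: le_trans (lerD IH (lexx _)) _.
  have -> : (c - N = (c - N.+1).+1)%N by rewrite subnSK.
  by rewrite exprS; lra.
have -> : `|N - c|%N = (N - c)%N by rewrite distnEl.
rewrite subSn// exprS.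
move: IH; case: ifP => [Nc|_] IH; last by lra.
have -> : N = c by apply/eqP; rewrite eqn_leq Nc.
by move: IH; rewrite (_ : N = c) ?subnn ?expr0; [lra|apply/eqP; rewrite eqn_leq Nc].
Qed.

(** Each point of the net is counted with weight
    [2^(3n - sum_i |k_i|) >= 1].  The sum of these weights over all grid points
    factorizes over the coordinates. *)
Lemma card_net : #|net|%:R <= (24 : R) ^+ n.
Proof.
pose g (j : 'I_(6 * n).+1) : R := 2^-1 ^+ grid_dist j.
have g0 j : 0 <= g j by rewrite exprn_ge0// invr_ge0.
apply: (@le_trans _ _ (\sum_(k : {ffun 'I_n -> 'I_(6 * n).+1})
    2 ^+ (3 * n) * \prod_i g (k i))).
  rewrite -sumr_const (bigID [in net] predT)/= ler_wpDr//.
    apply: sumr_ge0 => k _; rewrite mulr_ge0 ?exprn_ge0//.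
    by apply: prodr_ge0 => i _.
  apply: ler_sum => k; rewrite inE => /andP[kn _].
  rewrite /g prodrXr exprVn ler_pdivlMr ?exprn_gt0// mul1r.
  by rewrite ler_eXn2l// ltr1n.
rewrite -mulr_sumr -(bigA_distr_bigA (fun _ j => g j)).
rewrite (_ : (24 : R) = 2 ^+ 3 * 3); last by lra.
rewrite exprMn -exprM ler_wpM2l ?exprn_ge0//.
rewrite prodr_const card_ord lerXn2r ?nnegrE ?sumr_ge0//.
rewrite -(big_mkord predT (fun j => 2^-1 ^+ `|j - 3 * n|%N)).
exact: sum_half_pow_dist.
Qed.

Hypothesis n0 : (0 < n)%N.

(** Round down each coordinate of [2 sqrt n * x].  The [l^1] norm of the rounded
    integer vector is at most [2 sqrt n * |x|_1 + n <= 3n] by Cauchy-Schwarz. *)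
Lemma net_approx (x : 'cV[R]_n) : norm2 x <= 1 ->
  exists2 k, k \in net & norm2 (x - grid_point k) <= 1 / 2.
Proof.
move=> x1.
set q := Num.sqrt (n%:R : R).
have q1 : 1 <= q by rewrite -sqrtr1 ler_sqrt ?ler1n.
have q0 : 0 < q by lra.
have qq : q ^+ 2 = n%:R by rewrite sqr_sqrtr.
have n1 : 1 <= n%:R :> R by rewrite ler1n.
have qn : q <= n%:R by rewrite -qq expr2 ler_peMl// ltW.
have xi i : `|x i 0| <= 1 by exact: le_trans (norm2_entry x i 0) x1.
pose a i := 2 * q * x i 0 + (3 * n)%:R.
have a0 i : 0 <= a i.
  rewrite /a natrM; have := xi i; rewrite ler_norml => /andP[h _].
  nra.
have an i : (Num.truncn (a i) < (6 * n).+1)%N.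
  rewrite ltnS -(ler_nat R) (@le_trans _ _ (a i)) ?truncn_le//.
  rewrite /a !natrM; have := xi i; rewrite ler_norml => /andP[_ h].
  nra.
pose k : {ffun 'I_n -> 'I_(6 * n).+1} := [ffun i => Ordinal (an i)].
have ke i : (k i)%:R <= a i < (k i)%:R + 1.
  by rewrite ffunE/= truncn_le a0/= natr1 truncnS_gt.
have err : norm2 (x - grid_point k) <= 1 / 2.
  rewrite norm2_le; last by lra.
  rewrite sqr_norm2_col.
  apply: (@le_trans _ _ (\sum_(i < n) (1 / (4 * n%:R)))).
    apply: ler_sum => i _; rewrite !mxE.
    have -> : x i 0 - ((k i)%:R - (3 * n)%:R) / (2 * Num.sqrt n%:R) =
       (a i - (k i)%:R) / (2 * q).
      by rewrite /a -/q; field; rewrite gt_eqF.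
    rewrite expr_div_n exprMn qq.
    have -> : 2 ^+ 2 = 4 :> R by lra.
    rewrite ler_wpM2r ?invr_ge0 ?mulr_ge0//.
    have := ke i; move: (a i) (nat_of_ord (k i))%:R => u v /andP[uv vu]; nra.
  rewrite sumr_const card_ord -mulr_natl.
  by rewrite le_eqVlt; apply/orP; left; apply/eqP; field; lra.
exists k => //; rewrite inE; apply/andP; split.
  rewrite -(ler_nat R) natr_sum.
  have dE i : (grid_dist (k i))%:R = `|(k i)%:R - (3 * n)%:R| :> R.
    rewrite /grid_dist; case: (leqP (3 * n) (k i)) => [h|/ltnW h].
      by rewrite distnEl// natrB// ger0_norm// subr_ge0 ler_nat.
    by rewrite distnEr// natrB// ler0_norm ?opprB// subr_le0 ler_nat.
  apply: (@le_trans _ _ (\sum_i (2 * q * `|x i 0| + 1))).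
    apply: ler_sum => i _; rewrite dE.
    have := ke i; rewrite /a => /andP[h1 h2].
    rewrite -(gtr0_norm (_ : 0 < 2 * q)) ?mulr_gt0// -normrM.
    have := ler_norm (2 * q * x i 0); have := ler_norm (- (2 * q * x i 0)).
    rewrite normrN => h3 h4; rewrite ler_norml; lra.
  rewrite big_split/= sumr_const card_ord -mulr_sumr.
  have s1 : \sum_i `|x i 0| <= q.
    have := cauchy_schwarz_sum (fun i : 'I_n => `|x i 0|) (fun _ => 1).
    under eq_bigr do rewrite mulr1.
    under [X in _ <= X * _]eq_bigr do rewrite real_normK ?num_real//.
    rewrite -sqr_norm2_col expr1n sumr_const card_ord -[1 *+ n]/(n%:R) -qq.
    have s0 : 0 <= \sum_i `|x i 0| by apply: sumr_ge0.
    have := norm2_ge0 x.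
    rewrite -exprMn => z0; rewrite ler_pXn2r ?nnegrE ?mulr_ge0 ?(ltW q0)//.
    by move/le_trans; apply; rewrite ler_piMl// ltW.
  rewrite natrM -[1 *+ n]/(n%:R); nra.
have := ler_norm2B (grid_point k) x.
by rewrite -(norm2N (grid_point k - x)) opprB; lra.
Qed.

(** A vector is dominated by twice its best inner product with the net, and
    every unit vector is within one half of the net; hence any bound [M] on the
    operator norm improves to [2 s + M / 2].  The fixed point of this map is
    [4 s], reached from the crude Hilbert-Schmidt bound. *)
Lemma opnorm_of_net (A : 'M[R]_n) (s : R) :
  (forall k l, k \in net -> l \in net ->
     \sum_i \sum_j grid_point k i 0 * (A i j * grid_point l j 0) <= s) ->
  forall v : 'cV[R]_n, norm2 (A *m v) <= 4 * s * norm2 v.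
Proof.
move=> netA.
have unit_scale (w : 'cV[R]_n) : w != 0 ->
    norm2 ((norm2 w)^-1 *: w) = 1 /\ 0 < norm2 w.
  move=> w0; have wp : 0 < norm2 w.
    rewrite lt_def norm2_ge0 andbT; apply: contraNneq w0.
    by move/norm2_eq0 => ->.
  by rewrite norm2Z ger0_norm ?invr_ge0 ?norm2_ge0// mulVf ?gt_eqF.
have dual (w : 'cV[R]_n) : exists2 k, k \in net &
    norm2 w <= 2 * \sum_i grid_point k i 0 * w i 0.
  have [->|w0] := eqVneq w 0.
    have [|k kn _] := @net_approx 0; first by rewrite norm20; lra.
    exists k => //; rewrite norm20 big1 ?mulr0// => i _.
    by rewrite [X in _ * X]mxE mulr0.
  have [x1 wp] := unit_scale w w0; set x := _ *: w in x1.
  have [|k kn xk] := @net_approx x; first by rewrite x1.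
  exists k => //.
  have -> : \sum_i grid_point k i 0 * w i 0 =
     norm2 w - \sum_i (x - grid_point k) i 0 * w i 0.
    rewrite -[X in X - _](_ : \sum_i x i 0 * w i 0 = norm2 w).
      by rewrite -sumrB; apply: eq_bigr => i _; rewrite !mxE; ring.
    under eq_bigr do rewrite /x mxE -mulrA -expr2.
    rewrite -mulr_sumr -sqr_norm2_col expr2 mulrA mulVf ?mul1r//.
    by rewrite gt_eqF.
  have cs := cauchy_schwarz_sum (fun i => (x - grid_point k) i 0)
    (fun i => w i 0).
  rewrite -!sqr_norm2_col -exprMn in cs.
  have cs' : \sum_i (x - grid_point k) i 0 * w i 0 <= 1 / 2 * norm2 w.
    apply: (@le_trans _ _ (norm2 (x - grid_point k) * norm2 w)); last first.
      by rewrite ler_wpM2r ?norm2_ge0.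
    apply: le_trans (ler_norm _) _.
    rewrite -(@ler_pXn2r _ 2)// ?nnegrE ?mulr_ge0 ?norm2_ge0//.
    by rewrite real_normK ?num_real.
  lra.
have netAv l : l \in net -> norm2 (A *m grid_point l) <= 2 * s.
  move=> ln; have [k kn] := dual (A *m grid_point l).
  move/le_trans; apply; rewrite ler_wpM2l//.
  apply: le_trans (netA k l kn ln); rewrite le_eqVlt; apply/orP; left.
  by apply/eqP/eq_bigr => i _; rewrite [X in _ * X]mxE mulr_sumr.
have s0 : 0 <= s.
  have [k kn _] := dual 0; have := netAv k kn.
  by have := norm2_ge0 (A *m grid_point k); lra.
have improve M : 0 <= M -> (forall v : 'cV[R]_n, norm2 (A *m v) <= M * norm2 v) ->
    forall v : 'cV[R]_n, norm2 (A *m v) <= (2 * s + M / 2) * norm2 v.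
  move=> M0 AM v; have [->|v0] := eqVneq v 0.
    by rewrite mulmx0 !norm20 mulr0.
  have [x1 vp] := unit_scale v v0; set x := _ *: v in x1.
  have [|l ln xl] := @net_approx x; first by rewrite x1.
  have vE : v = norm2 v *: x by rewrite scalerA divff ?scale1r// gt_eqF.
  clearbody x; rewrite {1}vE.
  rewrite -scalemxAr norm2Z ger0_norm ?norm2_ge0// mulrC.
  rewrite ler_wpM2r ?norm2_ge0//.
  rewrite -(subrK (grid_point l) x) mulmxDr addrC (le_trans (ler_norm2D _ _))//.
  rewrite lerD ?netAv// (le_trans (AM _))//.
  by rewrite ler_wpM2l//; lra.
have iter m (v : 'cV[R]_n) : norm2 (A *m v) <= (4 * s + norm2 A / 2 ^+ m) * norm2 v.
  elim: m v => [|m IH] v.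
    apply: le_trans (mulmx_norm2 A v) _; rewrite ler_wpM2r ?norm2_ge0//.
    by rewrite expr0 divr1; lra.
  apply: le_trans (improve _ _ IH v) _.
    by rewrite addr_ge0 ?divr_ge0 ?norm2_ge0 ?exprn_ge0//; lra.
  rewrite ler_wpM2r ?norm2_ge0// exprS le_eqVlt; apply/orP; left; apply/eqP.
  by field; rewrite expf_eq0 andbC; apply/negP => /andP[/eqP]; lra.
move=> v; apply/ler_addgt0Pr => e e0.
set B := norm2 A * norm2 v.
have B0 : 0 <= B by rewrite mulr_ge0 ?norm2_ge0.
pose m := (Num.truncn (B / e)).+1.
have Bm : B < e * m%:R.
  by rewrite -ltr_pdivrMl// mulrC truncnS_gt.
apply: le_trans (iter m v) _; rewrite mulrDl lerD2l mulrAC -/B.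
rewrite ler_pdivrMr ?exprn_gt0//; apply/ltW/(lt_le_trans Bm).
rewrite ler_pM2l// -natrX ler_nat ltnW//; exact: ltn_expl.
Qed.

End Net.

(** * Bilinear forms of symmetric matrices, union bound *)

Section UpperTriangle.
Context {R : realType} {n : nat}.

Definition upper : {set 'I_n * 'I_n} :=
  [set ij : 'I_n * 'I_n | (ij.1 <= ij.2)%N]%SET.

Lemma sum_upper (f : 'I_n -> 'I_n -> R) :
  \sum_i \sum_j f i j =
  \sum_(e in upper) (f e.1 e.2 + (e.1 != e.2)%:R * f e.2 e.1).
Proof.
rewrite pair_big/= (bigID [in upper])/= big_split/=; congr (_ + _).
rewrite (reindex_inj (h := fun e : 'I_n * 'I_n => (e.2, e.1))) /=; last first.
  by move=> [a b] [c e] /= [-> ->].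
rewrite [RHS]big_mkcond [LHS]big_mkcond; apply: eq_bigr => -[i j] _ /=.
rewrite !inE/= -ltnNge -val_eqE/=.
by case: ltngtP => //=; rewrite ?mul1r ?mul0r.
Qed.

(** The coefficient of the upper-triangular entry [A e.1 e.2] in the bilinear
    form [u^T A v] of a symmetric matrix [A]. *)
Definition bilin_coef (u v : 'cV[R]_n) (e : 'I_n * 'I_n) : R :=
  u e.1 0 * v e.2 0 + (e.1 != e.2)%:R * (u e.2 0 * v e.1 0).

Lemma bilin_upper (A : 'M[R]_n) (u v : 'cV[R]_n) : A^T = A ->
  \sum_i \sum_j u i 0 * (A i j * v j 0) =
  \sum_(e in upper) bilin_coef u v e * A e.1 e.2.
Proof.
move=> symA; rewrite sum_upper; apply: eq_bigr => -[i j] _ /=.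
by rewrite -{2}symA mxE /bilin_coef /=; ring.
Qed.

Lemma sum_sqr_bilin_coef (u v : 'cV[R]_n) :
  \sum_(e in upper) bilin_coef u v e ^+ 2 <= 2 * (norm2 u ^+ 2 * norm2 v ^+ 2).
Proof.
have -> : norm2 u ^+ 2 * norm2 v ^+ 2 =
    \sum_i \sum_j (u i 0 ^+ 2 * v j 0 ^+ 2).
  rewrite !sqr_norm2_col mulr_suml; apply: eq_bigr => i _.
  by rewrite mulr_sumr.
rewrite sum_upper mulr_sumr; apply: ler_sum => -[i j] _.
rewrite /bilin_coef/=; case: eqP => _; rewrite !(mul0r, mul1r, addr0, exprMn).
  by rewrite -exprMn; have := sqr_ge0 (u i 0 * v j 0); lra.
rewrite -!exprMn.
move: (u i 0 * v j 0) (u j 0 * v i 0) => a b.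
by have := sqr_ge0 (a - b); nra.
Qed.

End UpperTriangle.

Lemma union_bound d (T : measurableType d) (R : realType)
    (P : probability T R) (I : finType) (A : {set I}) (F : I -> set T) (p : R) :
  (forall i, i \in A -> measurable (F i)) ->
  (forall i, i \in A -> (P (F i) <= p%:E)%E) ->
  measurable (\bigcup_(i in [set` A]) F i) /\
  (P (\bigcup_(i in [set` A]) F i) <= (#|A|%:R * p)%:E)%E.
Proof.
move=> mF PF.
have -> : \bigcup_(i in [set` A]) F i = \big[setU/set0]_(i <- enum A) F i.
  rewrite -bigcup_seq; apply/seteqP.
  by split => w [i /= iA Fw]; exists i; rewrite //= mem_enum in iA *.
rewrite cardE.
have : {subset enum A <= A} by move=> i; rewrite mem_enum.
elim: (enum A) => [_|i s IH sA].
  by rewrite big_nil measure0 mul0r.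
have {IH}[m1 p1] := IH (fun j js => sA j (mem_behead (s := i :: s) js)).
have iA : i \in A by apply: sA; rewrite mem_head.
rewrite big_cons; split; first by apply: measurableU => //; exact: mF.
apply: le_trans (measureU2 _ _ _) _ => //; first exact: mF.
by rewrite /= -natr1 mulrDl mul1r addrC EFinD leeD// PF.
Qed.

(** * Measurability of the iterates *)

Section LipschitzMeasurable.
Context {d : measure_display} {T : measurableType d} {R : realType}.

Lemma measurable_norm2 m n (V : T -> 'M[R]_(m, n)) :
  (forall i j, measurable_fun setT (fun w => V w i j)) ->
  measurable_fun setT (fun w => norm2 (V w)).
Proof.
move=> mV; apply: measurableT_comp (continuous_measurable_fun (@sqrt_continuous R)) _.
do 2 apply: measurable_sum => ?; apply: measurable_funX; exact: mV.
Qed.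

Lemma rat_row_approx s (g : 'rV[R]_s) (e : R) : 0 < e ->
  exists q : 'rV[rat]_s, norm2 (g - map_mx ratr q) < e.
Proof.
move=> e0.
pose dl := e / s.+1%:R.
have dl0 : 0 < dl by rewrite divr_gt0.
have ex j : {q : rat | ratr q \in `](g 0 j - dl), (g 0 j)[}.
  apply: cid; apply: rat_in_itvoo; lra.
exists (\row_j projT1 (ex j)).
apply: le_lt_trans (ler_norm2_sum _) _.
apply: (@le_lt_trans _ _ (\sum_(j < s) dl)).
  apply: ler_sum => j _; apply: le_trans (ler_norm2_abs _) _.
  rewrite big_ord1 !mxE.
  case: (ex j) => q /=; rewrite in_itv/= => /andP[q1 q2].
  rewrite ler_norml; lra.
rewrite sumr_const card_ord -mulr_natl /dl mulrA ltr_pdivrMr// mulrC.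
by rewrite ltr_pM2l// ltr_nat.
Qed.

(** The strict sublevel set of a Lipschitz function is the countable union,
    over rational points [q], of the sublevel sets of the cones
    [f q + L * |. - q|] that dominate it. *)
Lemma measurable_lipschitz s (f : 'rV[R]_s -> R) (L : R) (g : T -> 'rV[R]_s) :
  0 <= L -> (forall u v, `|f u - f v| <= L * norm2 (u - v)) ->
  (forall i, measurable_fun setT (fun w => g w 0 i)) ->
  measurable_fun setT (fun w => f (g w)).
Proof.
move=> L0 fL mg.
apply: (measurability _ (RGenInftyO.measurableE R)) => _ [_ [a ->] <-].
rewrite setTI.
have -> : (fun w => f (g w)) @^-1` `]-oo, a[%classic =
  \bigcup_(q in [set: 'rV[rat]_s])
    (fun w => f (map_mx ratr q) + L * norm2 (g w - map_mx ratr q))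
      @^-1` `]-oo, a[%classic.
  apply/seteqP; split => w /=; rewrite in_itv/=.
    move=> fa; pose e := (a - f (g w)) / (2 * L + 1).
    have e0 : 0 < e by rewrite divr_gt0//; lra.
    have [q qe] := rat_row_approx (g w) e0.
    exists q => //=; rewrite in_itv/=.
    have : f (map_mx ratr q) - f (g w) <= L * norm2 (g w - map_mx ratr q).
      by rewrite -(norm2N (_ - _)) opprB (le_trans (ler_norm _)).
    have : e * (2 * L + 1) = a - f (g w) by rewrite divfK// gt_eqF//; lra.
    have := norm2_ge0 (g w - map_mx ratr q).
    move: qe; set N := norm2 _ => qe N0 h1 h2; nra.
  move=> [q _ /=]; rewrite in_itv/= => h.
  have := fL (g w) (map_mx ratr q).
  by move=> /(le_trans (ler_norm _)); lra.
apply: countable_bigcupT_measurable; first exact: countableP.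
move=> q; rewrite -[X in measurable X]setTI.
suff : measurable_fun setT
    (fun w => f (map_mx ratr q) + L * norm2 (g w - map_mx ratr q)).
  by apply => //; exact: measurable_itv.
apply: measurable_funD => //; apply: measurable_funM => //.
apply: measurable_norm2 => i j.
rewrite (ord1 i); under eq_fun do rewrite mxE [X in _ + X]mxE.
exact: measurable_funB.
Qed.

End LipschitzMeasurable.

(** Only the steps [1, ..., t] are constrained, since the iterate [t] does not
    involve the others. *)
Definition lipschitz_upto {R : realType} {n : nat} (t : nat) (L : R)
    (H : forall s : nat, 'I_n -> 'rV[R]_s -> R) : Prop :=
  forall s, (1 <= s <= t)%N -> forall l,
    (forall u v, `|H s l u - H s l v| <= L * norm2 (u - v)) /\ `|H s l 0| <= L.

Lemma lip_normP {R : realType} {s : nat} (f : 'rV[R]_s -> R) (L : R) :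
  (lip_norm f <= L%:E)%E -> forall u v, `|f u - f v| <= L * norm2 (u - v).
Proof.
move=> fL u v; have [->|/eqP uv] := eqVneq u v.
  by rewrite !subrr norm20 normr0 mulr0.
have uv0 : 0 < norm2 (u - v).
  rewrite lt_def norm2_ge0 andbT; apply/eqP => /norm2_eq0/eqP.
  by rewrite subr_eq0 => /eqP.
rewrite -ler_pdivrMr// -lee_fin; apply: le_trans fL.
by apply: ereal_sup_ubound; exists u, v.
Qed.

Section GfomMeasurable.
Context {d : measure_display} {T : measurableType d} {R : realType} {n : nat}.
Variables (t : nat) (L : R) (F G : forall s : nat, 'I_n -> 'rV[R]_s -> R).
Hypotheses (L0 : 0 <= L) (lF : lipschitz_upto t L F) (lG : lipschitz_upto t L G).

Lemma measurable_row_sep (H : forall s : nat, 'I_n -> 'rV[R]_s -> R) s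
    (M : T -> 'M[R]_(n, s)) :
  lipschitz_upto t L H -> (1 <= s <= t)%N ->
  (forall l r, measurable_fun setT (fun w => M w l r)) ->
  forall l, measurable_fun setT (fun w => row_sep (@H s) (M w) l 0).
Proof.
move=> lH st mM l; rewrite /row_sep; under eq_fun do rewrite mxE.
apply: (measurable_lipschitz L0 (lH s st l).1) => i.
by under eq_fun do rewrite mxE; exact: mM.
Qed.

Lemma measurable_gfom (A : T -> 'M[R]_n) (z : T -> 'cV[R]_n) :
  (forall i j, measurable_fun setT (fun w => A w i j)) ->
  (forall i, measurable_fun setT (fun w => z w i 0)) ->
  forall r, (r <= t)%N -> forall i,
    measurable_fun setT (fun w => gfom (A w) F G (z w) r i 0).
Proof.
move=> mA mz r; have [m] := ubnP r; elim: m r => // m IH [_ _ i|r rm rt i].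
  exact: mz.
have mM l (q : 'I_r.+1) : measurable_fun setT (fun w =>
    (\matrix_(l < n, q < r.+1) gfom (A w) F G (z w) q l 0) l q).
  under eq_fun do rewrite mxE.
  apply: IH; last exact: leq_trans (ltnW (ltn_ord q)) rt.
  by apply: leq_trans (ltn_ord q) _.
under eq_fun do rewrite gfomS mxE.
apply: measurable_funD; last by apply: measurable_row_sep => //; exact: rt.
under eq_fun do rewrite mxE.
apply: measurable_sum => j; apply: measurable_funM => //.
by apply: measurable_row_sep => //; exact: rt.
Qed.

End GfomMeasurable.

(** * The leave-out comparison, path by path *)

Section RowSeparate.
Context {R : realType} {n : nat}.
Variables (t : nat) (L : R) (H : forall s : nat, 'I_n -> 'rV[R]_s -> R).
Hypotheses (L0 : 0 <= L) (lH : lipschitz_upto t L H).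

Lemma row_sep_lipschitz s (M M' : 'M[R]_(n, s)) : (1 <= s <= t)%N ->
  norm2 (row_sep (@H s) M - row_sep (@H s) M') <= L * norm2 (M - M').
Proof.
move=> st; rewrite norm2_le ?mulr_ge0 ?norm2_ge0// exprMn.
rewrite sqr_norm2_col sqr_norm2 mulr_sumr; apply: ler_sum => l _.
rewrite -real_normK ?num_real// !mxE.
have h := (lH st l).1 (row l M) (row l M').
apply: (@le_trans _ _ ((L * norm2 (row l M - row l M')) ^+ 2)).
  by rewrite lerXn2r ?nnegrE ?mulr_ge0 ?norm2_ge0.
rewrite exprMn sqr_norm2_row.
by rewrite ler_wpM2l ?sqr_ge0//; apply: ler_sum => j _; rewrite !mxE.
Qed.

Lemma entry_growth s l (u : 'rV[R]_s) : (1 <= s <= t)%N ->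
  `|H l u| <= L * (1 + norm2 u).
Proof.
move=> st; have [lip H0] := lH st l.
have := lip u 0; rewrite subr0 => h.
have h' : `|H l u| <= `|H l u - H l (0 : 'rV_s)| + `|H l (0 : 'rV_s)|.
  by rewrite -{1}(subrK (H l (0 : 'rV_s)) (H l u)) ler_normD.
by rewrite mulrDr mulr1; lra.
Qed.

Lemma row_sep_growth s (M : 'M[R]_(n, s)) : (1 <= s <= t)%N ->
  norm2 (row_sep (@H s) M) <= L * (Num.sqrt n%:R + norm2 M).
Proof.
move=> st.
apply: le_trans (ler_norm2B _ (row_sep (@H s) 0)) _; rewrite mulrDr lerD//.
  rewrite norm2_le ?mulr_ge0 ?sqrtr_ge0// sqr_norm2_col exprMn sqr_sqrtr ?ler0n//.
  rewrite mulr_natr -[X in _ *+ X](card_ord n) -sumr_const.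
  apply: ler_sum => l _; rewrite mxE row0 -real_normK ?num_real//.
  by rewrite lerXn2r ?nnegrE// (lH st l).2.
by apply: le_trans (row_sep_lipschitz _ _ st) _; rewrite subr0.
Qed.

End RowSeparate.

Section Mask.
Context {R : realType} {n : nat}.

Definition mask (p : pred 'I_n) (v : 'cV[R]_n) : 'cV[R]_n :=
  \col_i (if p i then v i 0 else 0).

Lemma norm2_mask p v : norm2 (mask p v) <= norm2 v.
Proof.
rewrite norm2_le ?norm2_ge0// !sqr_norm2_col; apply: ler_sum => i _.
by rewrite mxE; case: ifP => // _; rewrite expr0n sqr_ge0.
Qed.

Lemma norm2_mask_set (S : {set 'I_n}) v :
  norm2 (mask [in S] v) <= \sum_(i in S) `|v i 0|.
Proof.
apply: le_trans (ler_norm2_abs _) _; rewrite [leRHS]big_mkcond.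
by apply: ler_sum => i _; rewrite mxE; case: ifP; rewrite ?normr0.
Qed.

Lemma leave_outE (S : {set 'I_n}) (A : 'M[R]_n) v :
  leave_out S A *m v = mask [predC S] (A *m mask [predC S] v).
Proof.
apply/colP => i; rewrite !mxE /=; case: ifP => iS.
  by apply: eq_bigr => j _; rewrite !mxE iS/=; case: ifP; rewrite ?mul0r ?mulr0.
by apply: big1 => j _; rewrite !mxE iS mul0r.
Qed.

(** The columns of [S] act on the coordinates in [S]; the rest of the
    discarded block is made of the rows of [S], seen from outside [S]. *)
Lemma leave_outB (S : {set 'I_n}) (A : 'M[R]_n) v :
  A *m v - leave_out S A *m v =
  A *m mask [in S] v + mask [in S] (A *m mask [predC S] v).
Proof.
have {1}-> : v = mask [in S] v + mask [predC S] v.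
  by apply/colP => i; rewrite !mxE/=; case: (i \in S); rewrite /= ?addr0 ?add0r.
rewrite mulmxDr leave_outE -addrA; congr (_ + _).
by apply/colP => i; rewrite !mxE/=; case: (i \in S); rewrite /= ?subrr ?subr0.
Qed.

End Mask.

Section History.
Context {R : realType} {n : nat}.
Variables (F G : forall s : nat, 'I_n -> 'rV[R]_s -> R) (z0 : 'cV[R]_n).

Definition history (B : 'M[R]_n) (s : nat) : 'M[R]_(n, s) :=
  \matrix_(l < n, q < s) gfom B F G z0 q l 0.

Lemma gfom_history B s : gfom B F G z0 s.+1 =
  B *m row_sep (@F s.+1) (history B s.+1) + row_sep (@G s.+1) (history B s.+1).
Proof. exact: gfomS. Qed.

Lemma norm2_history B s :
  norm2 (history B s) <= \sum_(q < s) norm2 (gfom B F G z0 q).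
Proof.
apply: le_trans (ler_norm2_sum _) _; apply: ler_sum => q _.
by rewrite (_ : col _ _ = gfom B F G z0 q)//; apply/colP => i; rewrite !mxE.
Qed.

Lemma norm2_historyB B B' s : norm2 (history B s - history B' s) <=
  \sum_(q < s) norm2 (gfom B F G z0 q - gfom B' F G z0 q).
Proof.
apply: le_trans (ler_norm2_sum _) _; apply: ler_sum => q _.
rewrite (_ : col _ _ = gfom B F G z0 q - gfom B' F G z0 q)//.
by apply/colP => i; rewrite !mxE.
Qed.

Lemma norm2_history_row B s l :
  norm2 (row l (history B s)) <= \sum_(q < s) `|gfom B F G z0 q l 0|.
Proof.
apply: le_trans (ler_norm2_sum _) _; apply: ler_sum => q _.
by apply: le_trans (ler_norm2_abs _) _; rewrite big_ord1 !mxE.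
Qed.

Variables (t : nat) (L M : R).
Hypotheses (L1 : 1 <= L) (M1 : 1 <= M).
Hypotheses (lF : lipschitz_upto t L F) (lG : lipschitz_upto t L G).

Let L0 : 0 <= L. Proof. exact: le_trans ler01 L1. Qed.
Let ML1 : 1 <= M * L. Proof. exact: mulr_ege1. Qed.
Let LML : L <= M * L. Proof. by rewrite ler_peMl. Qed.

(** Tracking the sum of all the norms up to step [s] turns the dependence on the
    whole history into a one-step recursion with factor
    [1 + M L + L <= 3 M L]. *)
Lemma gfom_growth (B : 'M[R]_n) :
  (forall v : 'cV[R]_n, norm2 (B *m v) <= M * norm2 v) ->
  forall s, (s <= t)%N ->
  Num.sqrt n%:R + \sum_(q < s.+1) norm2 (gfom B F G z0 q) <=
    (3 * (M * L)) ^+ s * (Num.sqrt n%:R + norm2 z0).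
Proof.
have L1' := L1; have M1' := M1; have ML1' := ML1; have LML' := LML.
move=> BM; elim=> [_|s IH st]; first by rewrite big_ord1 expr0 mul1r.
have {}IH := IH (ltnW st).
rewrite big_ord_recr/= addrA exprS -mulrA.
set Q := _ + _ in IH *.
have st' : (1 <= s.+1 <= t)%N by [].
have rs (H : forall s : nat, 'I_n -> 'rV[R]_s -> R) : lipschitz_upto t L H ->
    norm2 (row_sep (@H s.+1) (history B s.+1)) <= L * Q.
  move=> lH; apply: le_trans (row_sep_growth L0 lH _ st') _.
  by rewrite ler_wpM2l// lerD2l norm2_history.
have Q0 : 0 <= Q.
  by rewrite addr_ge0 ?sqrtr_ge0// sumr_ge0// => q _; exact: norm2_ge0.
have : norm2 (gfom B F G z0 s.+1) <= M * (L * Q) + L * Q.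
  rewrite gfom_history; apply: le_trans (ler_norm2D _ _) _.
  rewrite lerD ?rs//; apply: le_trans (BM _) _.
  by rewrite ler_wpM2l ?rs//; lra.
move=> h; apply: (@le_trans _ _ (3 * (M * L) * Q)); last first.
  by rewrite ler_wpM2l//; lra.
have : Q <= M * L * Q by rewrite ler_peMl.
have : L * Q <= M * L * Q by rewrite ler_wpM2r.
lra.
Qed.

(** The rows of [leave_out S A] in [S] vanish, so these coordinates only feel
    their own past through [G]. *)
Lemma left_out_growth (S : {set 'I_n}) (A : 'M[R]_n) k : k \in S ->
  forall s, (s <= t)%N ->
  1 + \sum_(q < s.+1) `|gfom (leave_out S A) F G z0 q k 0| <=
    (2 * L) ^+ s * (1 + `|z0 k 0|).
Proof.
have L1' := L1.
move=> kS; elim=> [_|s IH st]; first by rewrite big_ord1 expr0 mul1r.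
have {}IH := IH (ltnW st).
rewrite big_ord_recr/= addrA exprS -mulrA.
set Q := 1 + _ in IH *.
have st' : (1 <= s.+1 <= t)%N by [].
have Q0 : 0 <= Q by rewrite addr_ge0// sumr_ge0.
have : `|gfom (leave_out S A) F G z0 s.+1 k 0| <= L * Q.
  rewrite gfom_history leave_outE !mxE /= kS add0r.
  apply: le_trans (entry_growth lG _ _ st') _.
  by rewrite ler_wpM2l// lerD2l norm2_history_row.
move=> h; apply: (@le_trans _ _ (2 * L * Q)); last first.
  by rewrite ler_wpM2l//; lra.
have : Q <= L * Q by rewrite ler_peMl.
lra.
Qed.

Section LeaveOut.
Variables (S : {set 'I_n}) (A : 'M[R]_n) (a : R).
Hypothesis a1 : 1 <= a.
Hypothesis n0 : (0 < n)%N.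
Hypothesis AM : forall v : 'cV[R]_n, norm2 (A *m v) <= M * norm2 v.

Let v s := row_sep (@F s) (history (leave_out S A) s).

Hypothesis rowA : forall s, (1 <= s <= t)%N -> forall i, i \in S ->
  `|\sum_(j | j \notin S) A i j * v s j 0| <= M * a * norm2 (v s) / Num.sqrt n%:R.

Let W := 1 + \big[Num.max/0]_(k in S) `|z0 k 0|
  + (Num.sqrt n%:R)^-1 * norm2 z0.

Let q0 : 0 < Num.sqrt (n%:R : R).
Proof. by rewrite sqrtr_gt0 ltr0n. Qed.

Lemma leave_out_opnorm (u : 'cV[R]_n) : norm2 (leave_out S A *m u) <= M * norm2 u.
Proof.
have L1' := L1; have M1' := M1; have ML1' := ML1; have LML' := LML.
rewrite leave_outE; apply: le_trans (norm2_mask _ _) _; apply: le_trans (AM _) _.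
by rewrite ler_wpM2l ?norm2_mask//; lra.
Qed.

(** The columns of [S] contribute [M L (2 L)^s (1 + |z0 j|)] for each [j] in
    [S], and each row [i] in [S] contributes [M a |v| / sqrt n], where [a]
    stands for [sqrt x] and [|v|] is bounded by [gfom_growth]. *)
Lemma leave_out_source s : (s < t)%N ->
  norm2 (A *m v s.+1 - leave_out S A *m v s.+1) <=
    (3 * (M * L)) ^+ s.+1 * (#|S|%:R * a * W).
Proof.
have a1' := a1; have L1' := L1; have M1' := M1; have ML1' := ML1; have LML' := LML.
move=> st; have st' : (1 <= s.+1 <= t)%N by [].
pose m := \big[Num.max/0]_(k in S) `|z0 k 0|.
pose q := (Num.sqrt n%:R)^-1 * norm2 z0.
have m0 : 0 <= m by rewrite /m; elim/big_rec: _ => // i x _ x0; rewrite le_max x0 orbT.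
have q'0 : 0 <= q by rewrite mulr_ge0 ?invr_ge0 ?norm2_ge0 ?sqrtr_ge0.
set B := 3 * (M * L).
have B1 : 1 <= B by rewrite /B; lra.
have Bs0 : 0 <= B ^+ s by rewrite exprn_ge0//; lra.
have vS j : j \in S -> `|v s.+1 j 0| <= L * (B ^+ s * (1 + m)).
  move=> jS; rewrite mxE; apply: le_trans (entry_growth lF _ _ st') _.
  rewrite ler_wpM2l//.
  apply: (@le_trans _ _ (1 + \sum_(q < s.+1) `|gfom (leave_out S A) F G z0 q j 0|)).
    by rewrite lerD2l norm2_history_row.
  apply: le_trans (left_out_growth A jS (ltnW st)) _.
  apply: ler_pM => //.
  - by rewrite exprn_ge0//; lra.
  - by rewrite lerXn2r ?nnegrE /B; nra.
  - by rewrite lerD2l /m (bigD1 j)//= le_max lexx.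
have vn : norm2 (v s.+1) <= L * (B ^+ s * (Num.sqrt n%:R * (1 + q))).
  apply: le_trans (row_sep_growth L0 lF _ st') _; rewrite ler_wpM2l//.
  have := gfom_growth leave_out_opnorm (ltnW st).
  have -> : Num.sqrt n%:R + norm2 z0 = Num.sqrt n%:R * (1 + q).
    by rewrite mulrDr mulr1 mulrA mulfV ?mul1r// gt_eqF.
  by apply: le_trans; rewrite lerD2l norm2_history.
rewrite leave_outB; apply: le_trans (ler_norm2D _ _) _.
have e1 : norm2 (A *m mask [in S] (v s.+1)) <=
    #|S|%:R * (M * (L * (B ^+ s * (1 + m)))).
  apply: le_trans (AM _) _; rewrite mulrCA ler_wpM2l//; first by lra.
  apply: le_trans (norm2_mask_set _ _) _.
  by rewrite mulr_natl -sumr_const; apply: ler_sum => j; exact: vS.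
have e2 : norm2 (mask [in S] (A *m mask [predC S] (v s.+1))) <=
    #|S|%:R * (M * a * (L * (B ^+ s * (1 + q)))).
  apply: le_trans (norm2_mask_set _ _) _.
  rewrite mulr_natl -sumr_const; apply: ler_sum => i iS.
  have -> : (A *m mask [predC S] (v s.+1)) i 0 =
      \sum_(j | j \notin S) A i j * v s.+1 j 0.
    rewrite mxE [RHS]big_mkcond; apply: eq_bigr => j _; rewrite [X in _ * X]mxE/=.
    by case: ifP; rewrite ?mulr0.
  apply: le_trans (rowA st' iS) _.
  rewrite -mulrA ler_wpM2l//; first by rewrite mulr_ge0; lra.
  rewrite ler_pdivrMr//; apply: le_trans vn _.
  by rewrite le_eqVlt; apply/orP; left; apply/eqP; ring.
apply: le_trans (lerD e1 e2) _.
have -> : #|S|%:R * (M * (L * (B ^+ s * (1 + m)))) +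
  #|S|%:R * (M * a * (L * (B ^+ s * (1 + q)))) =
  (#|S|%:R * (M * L * B ^+ s)) * ((1 + m) + a * (1 + q)) by ring.
have -> : B ^+ s.+1 * (#|S|%:R * a * W) =
  (#|S|%:R * (M * L * B ^+ s)) * (3 * (a * W)) by rewrite exprS /B; ring.
rewrite ler_wpM2l//; first by rewrite !mulr_ge0//; lra.
rewrite -[W]/(1 + m + q); nra.
Qed.

(** A linear recursion with factor [B = 3 M L] and source [B^s E] produces
    [s B^s E]; the factor [s] is absorbed by [2^s]. *)
Lemma leave_out_pathwise s : (s <= t)%N ->
  \sum_(q < s.+1) norm2 (gfom A F G z0 q - gfom (leave_out S A) F G z0 q) <=
    (6 * (M * L)) ^+ s * (#|S|%:R * a * W).
Proof.
have a1' := a1; have L1' := L1; have M1' := M1; have ML1' := ML1; have LML' := LML.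
set B := 3 * (M * L); set E := #|S|%:R * a * W.
have B1 : 1 <= B by rewrite /B; lra.
have m0 : 0 <= \big[Num.max/0]_(k in S) `|z0 k 0|.
  by elim/big_rec: _ => // i x _ x0; rewrite le_max x0 orbT.
have E0 : 0 <= E.
  rewrite !mulr_ge0//; first by lra.
  by rewrite /W !addr_ge0// mulr_ge0 ?invr_ge0 ?norm2_ge0 ?sqrtr_ge0.
have -> : 6 * (M * L) = 2 * B by rewrite /B; ring.
elim: s => [_|s IH st].
  by rewrite big_ord1 subrr norm20 expr0 mul1r.
have {}IH := IH (ltnW st).
have st' : (1 <= s.+1 <= t)%N by [].
rewrite big_ord_recr/=; set D := \sum_(q < s.+1) _ in IH *.
have D0 : 0 <= D by apply: sumr_ge0 => q _; exact: norm2_ge0.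
have rs (H : forall s : nat, 'I_n -> 'rV[R]_s -> R) : lipschitz_upto t L H ->
    norm2 (row_sep (@H s.+1) (history A s.+1) -
           row_sep (@H s.+1) (history (leave_out S A) s.+1)) <= L * D.
  move=> lH; apply: le_trans (row_sep_lipschitz L0 lH _ _ st') _.
  by rewrite ler_wpM2l// norm2_historyB.
have step : norm2 (gfom A F G z0 s.+1 - gfom (leave_out S A) F G z0 s.+1) <=
    M * (L * D) + B ^+ s.+1 * E + L * D.
  rewrite !gfom_history.
  set FA := row_sep (@F _) (history A _); set FS := row_sep (@F _) _.
  set GA := row_sep (@G _) (history A _); set GS := row_sep (@G _) _.
  have -> : A *m FA + GA - (leave_out S A *m FS + GS) =
    (A *m (FA - FS) + (A *m FS - leave_out S A *m FS)) + (GA - GS).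
    by rewrite mulmxBr; apply/colP => i; rewrite !mxE; ring.
  apply: le_trans (ler_norm2D _ _) _; rewrite lerD ?rs//.
  apply: le_trans (ler_norm2D _ _) _; rewrite lerD//.
    by apply: le_trans (AM _) _; rewrite ler_wpM2l ?rs//; lra.
  exact: leave_out_source.
apply: (@le_trans _ _ (B * D + B ^+ s.+1 * E)).
  have : L * D <= M * L * D by rewrite ler_wpM2r.
  have : D <= M * L * D by rewrite ler_peMl.
  by rewrite /B; lra.
have p1 : 1 <= 2 ^+ s :> R by rewrite exprn_ege1//; lra.
have B0 : 0 <= B by apply: le_trans B1.
have BE : 0 <= B * B ^+ s * E.
  by apply: mulr_ge0 => //; apply: mulr_ge0 => //; exact: exprn_ge0.
have := ler_wpM2l B0 IH.
have -> : B * ((2 * B) ^+ s * E) = 2 ^+ s * (B * B ^+ s * E).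
  by rewrite exprMn; ring.
have -> : (2 * B) ^+ s.+1 * E = 2 * (2 ^+ s * (B * B ^+ s * E)).
  by rewrite exprMn !exprS; ring.
have -> : B ^+ s.+1 * E = B * B ^+ s * E by rewrite exprS.
have : B * B ^+ s * E <= 2 ^+ s * (B * B ^+ s * E) by rewrite ler_peMl.
lra.
Qed.

End LeaveOut.
End History.

(** * Tails for the random matrix *)

Section WignerTails.
Context {d : measure_display} {T : measurableType d} {R : realType} {n : nat}.
Variable P : probability T R.
Variables (A0 : T -> 'M[R]_n) (K : R).
Let X (e : 'I_n * 'I_n) (w : T) := A0 w e.1 e.2.
Hypothesis n0 : (0 < n)%N.
Hypothesis K0 : 0 < K.
Hypothesis mA0 : forall i j, measurable_fun setT (fun w => A0 w i j).
Hypothesis symA0 : forall w, (A0 w)^T = A0 w.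
Hypothesis indA0 : mutually_independent P upper X.
Hypothesis subA0 : forall i j, subgaussian P (8 * K ^+ 2) (fun w => A0 w i j).

Let mX e : measurable_fun setT (X e). Proof. exact: mA0. Qed.
Let subX e : e \in upper -> subgaussian P (8 * K ^+ 2) (X e).
Proof. by move=> _; exact: subA0. Qed.
Let k0 : 0 < 8 * K ^+ 2. Proof. by rewrite mulr_gt0// exprn_gt0. Qed.

Lemma expR5_ge24 : 24 <= expR 5 :> R.
Proof.
have e1 : 2 <= expR 1 :> R by have := expR_ge1Dx (1 : R); lra.
apply: (@le_trans _ _ (2 ^+ 5)); first by lra.
apply: (@le_trans _ _ (expR 1 ^+ 5)).
  by rewrite lerXn2r ?nnegrE ?expR_ge0.
by rewrite -expRM_natl mulr1.
Qed.

(** There are at most [24^(2n) <= expR (10 n)] pairs of net points, and the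
    threshold [s] is chosen so that each bilinear form exceeds it with
    probability at most [expR (- (10 n + x))]. *)
Lemma opnorm_tail (x : R) : 0 <= x -> exists B : set T,
  [/\ measurable B, (P B <= (expR (- x))%:E)%E &
    forall w, ~ B w -> forall v : 'cV[R]_n, norm2 (A0 w *m v) <=
      512 * K * (Num.sqrt n%:R + Num.sqrt x) * norm2 v].
Proof.
move=> x0.
set s := 128 * K * (Num.sqrt n%:R + Num.sqrt x).
have s0 : 0 <= s by rewrite !mulr_ge0 ?addr_ge0 ?sqrtr_ge0// ltW.
pose E : {set {ffun 'I_n -> 'I_(6 * n).+1} * {ffun 'I_n -> 'I_(6 * n).+1}} :=
  finset.setX (net n (R := R)) (net n (R := R)).
pose Bf (p : {ffun 'I_n -> 'I_(6 * n).+1} * {ffun 'I_n -> 'I_(6 * n).+1}) :=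
  [set w | s <= \sum_(e in upper)
     bilin_coef (grid_point (R := R) p.1) (grid_point p.2) e * X e w].
have mBf p : p \in E -> measurable (Bf p).
  move=> _; rewrite -[X in measurable X]setTI; apply: measurable_fun_le => //.
  under eq_fun do rewrite -big_enum.
  by apply: measurable_sum => e; apply: measurable_funM.
(* Net points have norm at most 2, so the squared coefficients of a bilinear
   form sum up to at most [2 * (4 * 4)]. *)
have PBf p : p \in E -> (P (Bf p) <= (expR (- (10 * n%:R + x)))%:E)%E.
  rewrite !inE => /andP[/andP[_ p1] /andP[_ p2]].
  apply: le_trans (subgaussian_tail (J := upper)
    (b := fun e _ => bilin_coef (grid_point p.1) (grid_point p.2) e)
    (beta := 32) mX indA0 subX _ k0 _ s0 _ _) _ => //.
  - move=> _; apply: le_trans (sum_sqr_bilin_coef _ _) _.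
    rewrite -exprMn.
    have : norm2 (grid_point (R := R) p.1) * norm2 (grid_point (R := R) p.2) <= 2 * 2.
      by apply: ler_pM; rewrite ?norm2_ge0.
    have : 0 <= norm2 (grid_point (R := R) p.1) * norm2 (grid_point (R := R) p.2).
      by rewrite mulr_ge0 ?norm2_ge0.
    by move: (_ * _) => u; nra.
  rewrite lee_fin ler_expR lerN2.
  have -> : s ^+ 2 / (4 * (8 * K ^+ 2) * 32) =
      16 * (Num.sqrt n%:R + Num.sqrt x) ^+ 2.
    by rewrite /s; field; rewrite gt_eqF.
  rewrite sqrrD !sqr_sqrtr//.
  have : 0 <= Num.sqrt n%:R * Num.sqrt x by rewrite mulr_ge0 ?sqrtr_ge0.
  have : 0 <= n%:R :> R by [].
  rewrite -mulr_natl; lra.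
have [mB PB] := union_bound mBf PBf.
exists (\bigcup_(p in [set` E]) Bf p); split => //.
  apply: le_trans PB _; rewrite lee_fin opprD expRD mulrA ler_piMl ?expR_ge0//.
  rewrite expRN ler_pdivrMr ?expR_gt0// mul1r finset.cardsX natrM.
  have -> : expR (10 * n%:R) = (expR 5 ^+ n) * (expR 5 ^+ n) :> R.
    rewrite -!expRM_natl -expRD; congr expR; ring.
  have c : #|net n (R := R)|%:R <= expR 5 ^+ n :> R.
    apply: le_trans (card_net n) _.
    by rewrite lerXn2r ?nnegrE ?expR_ge0 ?expR5_ge24.
  exact: ler_pM.
move=> w Bw v.
have -> : 512 * K * (Num.sqrt n%:R + Num.sqrt x) = 4 * s by rewrite /s; ring.
apply: opnorm_of_net => // k l kn ln.
rewrite bilin_upper//; apply/ltW; rewrite ltNge; apply/negP => h.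
by apply: Bw; exists (k, l) => //=; rewrite finset.in_setX kn ln.
Qed.

Variable S : {set 'I_n}.

(** The entries erased by leaving [S] out; the others generate the
    sigma-algebra [free_gen] to which the leave-out iterates are adapted. *)
Definition touching : {set 'I_n * 'I_n} :=
  [set e in upper | (e.1 \in S) || (e.2 \in S)]%SET.

Definition free_gen : set (set T) := family_gen X (upper :\: touching).

(** Dividing by the random norm of [v] leaves coefficients of bounded norm that
    are still measurable with respect to [free_gen], so that [subgaussian_tail]
    applies to the entries in [touching], with both signs. *)
Lemma row_tail (i : 'I_n) (v : T -> 'cV[R]_n) (x : R) : i \in S -> 0 <= x ->
  (forall j, measurable_fun setT
     ((fun w => v w j 0) : g_sigma_algebraType free_gen -> R)) ->
  exists B : set T,
  [/\ measurable B, (P B <= (2 * expR (- x))%:E)%E &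
    forall w, ~ B w -> `|\sum_(j | j \notin S) A0 w i j * v w j 0| <=
      8 * K * Num.sqrt x * norm2 (v w)].
Proof.
move=> iS x0 mv.
(* With [beta = 2] below, [tau ^+ 2 / (4 * (8 * K ^+ 2) * 2) = x]. *)
set tau := 8 * K * Num.sqrt x.
have tau0 : 0 <= tau by rewrite !mulr_ge0 ?sqrtr_ge0// ltW.
pose nv w := mask [predC S] ((norm2 (v w))^-1 *: v w).
pose di : 'cV[R]_n := \col_k (k == i)%:R.
have diE : norm2 di ^+ 2 = 1.
  rewrite sqr_norm2_col (bigD1 i)//= mxE eqxx expr1n big1 ?addr0// => k ki.
  by rewrite mxE (negbTE ki) expr0n.
have nv1 w : norm2 (nv w) ^+ 2 <= 1.
  rewrite -(expr1n _ 2) -norm2_le//; apply: le_trans (norm2_mask _ _) _.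
  rewrite norm2Z ger0_norm ?invr_ge0 ?norm2_ge0//.
  have [->|v0] := eqVneq (norm2 (v w)) 0; first by rewrite mulr0.
  by rewrite mulVf.
have mnv j : measurable_fun setT
     ((fun w => nv w j 0) : g_sigma_algebraType free_gen -> R).
  rewrite /nv; under eq_fun do rewrite mxE mxE /=.
  case: (j \in S) => /=; first exact: measurable_cst.
  apply: measurable_funM => //.
  under eq_fun do rewrite -powR_inv1 ?norm2_ge0//.
  apply: (measurableT_comp (measurable_powR (-1))).
  by apply: measurable_norm2 => a b; rewrite (ord1 b); exact: mv.
pose b (c : R) e w := c * bilin_coef di (nv w) e.
have bE c w : \sum_(e in touching) b c e w * X e w =
    c * ((norm2 (v w))^-1 * \sum_(j | j \notin S) A0 w i j * v w j 0).
  have -> : \sum_(e in touching) b c e w * X e w =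
      c * \sum_(e in upper) bilin_coef di (nv w) e * A0 w e.1 e.2.
    rewrite mulr_sumr big_mkcond [RHS]big_mkcond; apply: eq_bigr => e _.
    rewrite [e \in touching]inE; case: (e \in upper) => //=.
    case: ifP => eS; first by rewrite /b /X -mulrA.
    move/negbT: eS; rewrite negb_or => /andP[e1 e2].
    rewrite /bilin_coef !mxE.
    have -> : e.1 == i = false by apply/eqP => h; move: e1; rewrite h iS.
    have -> : e.2 == i = false by apply/eqP => h; move: e2; rewrite h iS.
    by rewrite !(mul0r, mulr0, addr0).
  congr (c * _); rewrite -bilin_upper// (bigD1 i)//= [X in _ + X]big1 ?addr0.
    rewrite mulr_sumr [RHS]big_mkcond/=; apply: eq_bigr => j _.
    rewrite !mxE eqxx mul1r/=; case: ifP; last by rewrite mulr0.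
    by move=> _; ring.
  move=> k ki; apply: big1 => j _; by rewrite mxE (negbTE ki) mul0r.
have mb c e : e \in touching -> measurable_fun setT
    (b c e : g_sigma_algebraType free_gen -> R).
  move=> _; apply: measurable_funM => //; rewrite /bilin_coef.
  apply: measurable_funD; first exact: measurable_funM.
  by apply: measurable_funM => //; exact: measurable_funM.
have sb c w : `|c| = 1 -> \sum_(e in touching) b c e w ^+ 2 <= 2.
  move=> c1; apply: (@le_trans _ _
      (\sum_(e in upper) bilin_coef di (nv w) e ^+ 2)).
    rewrite [leRHS]big_mkcond [leLHS]big_mkcond; apply: ler_sum => e _.
    rewrite [e \in touching]inE; case: (e \in upper) => //=.
    case: ifP => _; last exact: sqr_ge0.
    by rewrite /b exprMn -(real_normK (num_real c)) c1 expr1n mul1r.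
  apply: le_trans (sum_sqr_bilin_coef _ _) _.
  by rewrite diE mul1r; have := nv1 w; lra.
have TU : touching \subset upper.
  by apply/fintype.subsetP => e; rewrite inE => /andP[].
pose Bc c := [set w | tau <= \sum_(e in touching) b c e w * X e w].
have PBc c : `|c| = 1 -> (P (Bc c) <= (expR (- x))%:E)%E.
  move=> c1; apply: le_trans (subgaussian_tail mX indA0 subX TU k0
    (ltr0n _ 2) tau0 (mb c) (fun w => sb c w c1)) _.
  rewrite lee_fin ler_expR lerN2 /tau !exprMn sqr_sqrtr//.
  rewrite le_eqVlt; apply/orP; left; apply/eqP; field.
  by rewrite gt_eqF.
have mBc c : measurable (Bc c).
  rewrite -[X in measurable X]setTI; apply: measurable_fun_le => //.
  under eq_fun do rewrite bE.
  apply: measurable_funM => //; apply: measurable_funM.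
    under eq_fun do rewrite -powR_inv1 ?norm2_ge0//.
    apply: (measurableT_comp (measurable_powR (-1))).
    apply: measurable_norm2 => a e; rewrite (ord1 e).
    exact: (measurable_family_T mX (mv a)).
  under eq_fun do rewrite big_mkcond/=.
  apply: measurable_sum => j; case: (j \notin S); last exact: measurable_cst.
  apply: measurable_funM => //.
  exact: (measurable_family_T mX (mv j)).
exists (Bc 1 `|` Bc (-1)); split; first exact: measurableU.
  apply: le_trans (measureU2 _ _ _) _ => //.
  rewrite mulr_natl mulr2n EFinD leeD// PBc// ?normrN ?normr1//.
move=> w /not_orP[]; rewrite /Bc /= !bE mul1r mulN1r => /negP; rewrite -ltNge => h1.
move=> /negP; rewrite -ltNge => h2.
have [v0|v0] := eqVneq (norm2 (v w)) 0.
  rewrite v0 mulr0 big1 ?normr0// => j _.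
  by rewrite (norm2_eq0 v0) mxE mulr0.
have vp : 0 < norm2 (v w) by rewrite lt_def v0 norm2_ge0.
have iv : 0 < (norm2 (v w))^-1 by rewrite invr_gt0.
rewrite -ler_pdivrMr// mulrC -(gtr0_norm iv) -normrM ler_norml.
by apply/andP; split; rewrite -/tau; lra.
Qed.

End WignerTails.

(** * Tails for a deterministic initialization *)

Section FixedInitialization.
Context {d : measure_display} {T : measurableType d} {R : realType} {n : nat}.
Variable P : probability T R.
Variables (A0 : T -> 'M[R]_n) (K : R).
Hypothesis n0 : (0 < n)%N.
Hypothesis K1 : 1 <= K.
Hypothesis mA0 : forall i j, measurable_fun setT (fun w => A0 w i j).
Hypothesis symA0 : forall w, (A0 w)^T = A0 w.
Hypothesis indA0 : mutually_independent P upper (fun e w => A0 w e.1 e.2).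
Hypothesis subA0 : forall i j, subgaussian P (8 * K ^+ 2) (fun w => A0 w i j).
Variables (F G : forall s : nat, 'I_n -> 'rV[R]_s -> R) (t : nat) (L : R).
Hypothesis L1 : 1 <= L.
Hypotheses (lF : lipschitz_upto t L F) (lG : lipschitz_upto t L G).

Let A w := (Num.sqrt n%:R)^-1 *: A0 w.
Let K0 : 0 < K. Proof. exact: lt_le_trans ltr01 K1. Qed.
Let q0 : 0 < Num.sqrt (n%:R : R).
Proof. by rewrite sqrtr_gt0 ltr0n. Qed.

(** The constants match as follows: [512 K (1 + sqrt (x / n))] bounds the
    operator norm of [A] and dominates the constant [8 K] of [row_tail], and
    six times it is the rate of [leave_out_pathwise]. *)
Lemma leave_out_tail (S : {set 'I_n}) (z0 : 'cV[R]_n) (x : R) : 1 <= x ->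
  exists B : set T,
  [/\ measurable B,
      (P B <= ((1 + 2 * t%:R * #|S|%:R) * expR (- x))%:E)%E &
    forall w, ~ B w ->
      norm2 (gfom (A w) F G z0 t - gfom (leave_out S (A w)) F G z0 t) <=
      (3072 * K * L * (1 + Num.sqrt (x / n%:R))) ^+ t *
      (#|S|%:R * Num.sqrt x *
       (1 + \big[Num.max/0]_(k in S) `|z0 k 0|
        + (Num.sqrt n%:R)^-1 * norm2 z0))].
Proof.
move=> x1; have x0 : 0 <= x by exact: le_trans ler01 x1.
have K1' := K1; have L1' := L1; have K0' := K0.
have [B1 [mB1 PB1 hB1]] := opnorm_tail n0 K0 mA0 symA0 indA0 subA0 x0.
pose v s w := row_sep (@F s) (history F G z0 (leave_out S (A w)) s).
pose X (e : 'I_n * 'I_n) (w : T) := A0 w e.1 e.2.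
have mX e : measurable_fun setT (X e) by exact: mA0.
have mv (s : 'I_t) j : measurable_fun setT
     ((fun w => v s.+1 w j 0) : g_sigma_algebraType (free_gen A0 S) -> R).
  apply: (measurable_row_sep (L := L) (t := t)) => //; first by lra.
    exact: ltn_ord s.
  move=> l q; under eq_fun do rewrite mxE.
  apply: (measurable_gfom (L := L) (t := t)) => //; first by lra.
    move=> i k; under eq_fun do rewrite mxE.
    case iS : (i \notin S) => /=; last exact: measurable_cst.
    case kS : (k \notin S) => /=; last exact: measurable_cst.
    under eq_fun do rewrite mxE.
    apply: measurable_funM => //.
    have [ik|ki] := leqP i k.
      by apply: (measurable_family_member (X := X) (e := (i, k)));
        rewrite !inE/= ik/= negb_or iS kS.
    under eq_fun do rewrite -[A0 _]symA0 mxE.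
    by apply: (measurable_family_member (X := X) (e := (k, i)));
      rewrite !inE/= (ltnW ki)/= negb_or iS kS.
  exact: leq_trans (ltnW (ltn_ord q)) (ltn_ord s).
have /choice[Bf hBf] : forall p : 'I_t * 'I_n, exists B : set T, p.2 \in S ->
  [/\ measurable B, (P B <= (2 * expR (- x))%:E)%E &
    forall w, ~ B w -> `|\sum_(j | j \notin S) A0 w p.2 j * v p.1.+1 w j 0| <=
      8 * K * Num.sqrt x * norm2 (v p.1.+1 w)].
  move=> [s i]; have [iS|iS] := boolP (i \in S); last by exists setT.
  have [B hB] := row_tail K0 mA0 symA0 indA0 subA0 iS x0 (mv s).
  by exists B.
pose E : {set 'I_t * 'I_n} := finset.setX [set: 'I_t]%SET S.
have [mB2 PB2] : measurable (\bigcup_(p in [set` E]) Bf p) /\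
   (P (\bigcup_(p in [set` E]) Bf p) <= (#|E|%:R * (2 * expR (- x)))%:E)%E.
  by apply: union_bound => p; rewrite inE => /andP[_ /hBf[]].
exists (B1 `|` \bigcup_(p in [set` E]) Bf p); split.
- exact: measurableU.
- apply: le_trans (measureU2 _ _ _) _ => //.
  apply: le_trans (leeD PB1 PB2) _; rewrite -EFinD lee_fin.
  rewrite finset.cardsX cardsT card_ord natrM.
  by rewrite le_eqVlt; apply/orP; left; apply/eqP; ring.
move=> w /not_orP[nB1 nB2].
pose M := 512 * K * (1 + Num.sqrt (x / n%:R)).
have sx : Num.sqrt x = Num.sqrt n%:R * Num.sqrt (x / n%:R).
  by rewrite -sqrtrM// mulrCA mulfV ?mulr1// pnatr_eq0 -lt0n.
have s0 : 0 <= Num.sqrt (x / n%:R) by exact: sqrtr_ge0.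
have M8 : 8 * K <= M by rewrite /M; nra.
have M1 : 1 <= M by lra.
have a1 : 1 <= Num.sqrt x by rewrite -sqrtr1 ler_wsqrtr.
have op (u : 'cV[R]_n) : norm2 (A w *m u) <= M * norm2 u.
  rewrite /A -scalemxAl norm2Z ger0_norm ?invr_ge0 ?sqrtr_ge0//.
  rewrite ler_pdivrMl//; apply: le_trans (hB1 w nB1 u) _.
  by rewrite sx /M le_eqVlt; apply/orP; left; apply/eqP; ring.
have row s : (1 <= s <= t)%N -> forall i, i \in S ->
  `|\sum_(j | j \notin S) A w i j * v s w j 0| <=
    M * Num.sqrt x * norm2 (v s w) / Num.sqrt n%:R.
  case: s => // s st i iS.
  have := hBf (Ordinal (st : (s < t)%N), i) iS => -[_ _ /(_ w)] /= h.
  have {}h := h (fun b => nB2 (ex_intro2 _ _ (Ordinal (st : (s < t)%N), i)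
    (_ : [set` E] _) b)).
  have -> : \sum_(j | j \notin S) A w i j * v s.+1 w j 0 =
      (Num.sqrt n%:R)^-1 * \sum_(j | j \notin S) A0 w i j * v s.+1 w j 0.
    by rewrite mulr_sumr; apply: eq_bigr => j _; rewrite mxE mulrA.
  rewrite normrM ger0_norm ?invr_ge0 ?sqrtr_ge0// mulrC ler_wpM2r ?invr_ge0 ?sqrtr_ge0//.
  apply: le_trans (h _) _; first by rewrite /= finset.in_setX inE.
  by rewrite ler_wpM2r ?norm2_ge0// ler_wpM2r ?sqrtr_ge0.
have := leave_out_pathwise L1 M1 lF lG a1 n0 op row (leqnn t).
have -> : 6 * (M * L) = 3072 * K * L * (1 + Num.sqrt (x / n%:R)).
  by rewrite /M; ring.
apply: le_trans; rewrite big_ord_recr/= lerDr.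
by apply: sumr_ge0 => q _; exact: norm2_ge0.
Qed.

End FixedInitialization.

Section SupNorm.
Context {R : realType} {n : nat}.

Lemma entry_le_norm (v : 'cV[R]_n) i : `|v i 0| <= `|v|.
Proof. by rewrite [leRHS]/Num.norm /= mx_normrE; apply/bigmax_geP; right; exists (i, 0). Qed.

Lemma norm_lt (v : 'cV[R]_n) c : 0 < c -> (forall i, `|v i 0| < c) -> `|v| < c.
Proof.
move=> c0 h; rewrite [ltLHS]/Num.norm /= mx_normrE; apply/bigmax_ltP; split => //.
by move=> [i j] _ /=; rewrite (ord1 j).
Qed.

Lemma norm2_le_norm (v : 'cV[R]_n) : norm2 v <= Num.sqrt n%:R * `|v|.
Proof.
rewrite norm2_le ?mulr_ge0 ?sqrtr_ge0// sqr_norm2_col exprMn sqr_sqrtr ?ler0n//.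
rewrite mulr_natl -[X in _ *+ X](card_ord n) -sumr_const; apply: ler_sum => i _.
by rewrite -real_normK ?num_real// lerXn2r ?nnegrE// entry_le_norm.
Qed.

End SupNorm.

Section FixedTails.
Context {d : measure_display} {T : measurableType d} {R : realType} {n : nat}.
Variable P : probability T R.
Variables (A0 : T -> 'M[R]_n) (K : R).
Hypothesis n0 : (0 < n)%N.
Hypothesis K2 : 2 <= K.
Hypothesis mA0 : forall i j, measurable_fun setT (fun w => A0 w i j).
Hypothesis symA0 : forall w, (A0 w)^T = A0 w.
Hypothesis indA0 : mutually_independent P upper (fun e w => A0 w e.1 e.2).
Hypothesis subA0 : forall i j, subgaussian P (8 * K ^+ 2) (fun w => A0 w i j).
Variables (F G : forall s : nat, 'I_n -> 'rV[R]_s -> R) (t : nat) (L : R).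
Hypothesis t0 : (0 < t)%N.
Hypothesis L2 : 2 <= L.
Hypotheses (lF : lipschitz_upto t L F) (lG : lipschitz_upto t L G).
Variable z0 : 'cV[R]_n.

Let A w := (Num.sqrt n%:R)^-1 *: A0 w.
Let z w := gfom (A w) F G z0 t.
Let zS S w := gfom (leave_out S (A w)) F G z0 t.
Let rate x := 3072 * K * L * (1 + Num.sqrt (x / n%:R)).

Let L1 : 1 <= L. Proof. by apply: le_trans L2; rewrite ler1n. Qed.
Let K1 : 1 <= K. Proof. by apply: le_trans K2; rewrite ler1n. Qed.

Let rate2 x : 2 < rate x.
Proof.
have K2' := K2; have L2' := L2; rewrite /rate.
have := sqrtr_ge0 (x / n%:R); set s := Num.sqrt _ => s0.
have : 4 <= K * L by nra.
set u := K * L => u4; rewrite -(mulrA 3072 K L) -/u; nra.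
Qed.

Lemma measurable_A i j : measurable_fun setT (fun w => A w i j).
Proof. by rewrite /A; under eq_fun do rewrite mxE; exact: measurable_funM. Qed.

Lemma measurable_leave_out_A (S : {set 'I_n}) i j :
  measurable_fun setT (fun w => leave_out S (A w) i j).
Proof.
under eq_fun do rewrite mxE.
case: (_ && _); [exact: measurable_A|exact: measurable_cst].
Qed.

Let mz i : measurable_fun setT (fun w => z w i 0).
Proof.
by apply: (measurable_gfom (L := L) (t := t)) => //;
  [exact: le_trans ler01 L1|exact: measurable_A].
Qed.

Let mzS S i : measurable_fun setT (fun w => zS S w i 0).
Proof.
by apply: (measurable_gfom (L := L) (t := t)) => //;
  [exact: le_trans ler01 L1|exact: measurable_leave_out_A].
Qed.

Let W (S : {set 'I_n}) := 1 + \big[Num.max/0]_(k in S) `|z0 k 0|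
  + (Num.sqrt n%:R)^-1 * norm2 z0.

Let W1 S : 1 <= W S.
Proof.
rewrite /W -addrA lerDl addr_ge0//; last first.
  by rewrite mulr_ge0 ?invr_ge0 ?norm2_ge0 ?sqrtr_ge0.
by elim/big_rec: _ => // i x _ x0; rewrite le_max x0 orbT.
Qed.

(** For [x < 1] the right-hand side exceeds 1; for [x >= 1] the event lies in
    the exceptional set of [leave_out_tail]. *)
Lemma tail_reduction (S : {set 'I_n}) (x : R) (E : set T) : (0 < #|S|)%N ->
  0 <= x -> measurable E ->
  (1 <= x -> forall w, norm2 (z w - zS S w) <=
      rate x ^+ t * (#|S|%:R * Num.sqrt x * W S) -> ~ E w) ->
  (P E <= (3072 * t%:R * #|S|%:R * expR (- (x / 3072)))%:E)%E.
Proof.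
move=> S0 x0 mE hE.
have tS : 1 <= t%:R * #|S|%:R :> R by rewrite -natrM ler1n muln_gt0 t0.
have -> : 3072 * t%:R * #|S|%:R * expR (- (x / 3072)) =
  t%:R * #|S|%:R * (3072 * expR (- (x / 3072))) :> R by ring.
have [x1|x1] := ltP x 1.
  apply: le_trans (probability_le1 _ mE) _; rewrite lee_fin.
  have e1 := expR_ge1Dx (- (x / 3072)).
  have : 1 <= 3072 * expR (- (x / 3072)) by lra.
  by move=> h; rewrite -[leLHS]mulr1; apply: ler_pM => //; lra.
have [B [mB PB hB]] := leave_out_tail n0 K1 mA0 symA0 indA0 subA0 L1 lF lG S z0 x1.
apply: (@le_trans _ _ (P B)).
  apply: le_measure; rewrite ?inE// => w Ew.
  by apply: contrapT => /hB h; exact: hE Ew.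
apply: le_trans PB _; rewrite lee_fin.
rewrite -(mulrA 2); move: tS; set u := _ * _ => u1.
have eq0 : 0 <= expR (- x) by exact: expR_ge0.
have : expR (- x) <= expR (- (x / 3072)) by rewrite ler_expR; lra.
move: (expR (- x)) (expR (- (x / 3072))) eq0 => a b a0 ab.
nra.
Qed.

(** The pathwise bound has the rate to the power [t]; the spare factor, larger
    than 2, makes the comparison with the threshold strict. *)
Lemma fixed_leave_out_tail (S : {set 'I_n}) (x : R) : (0 < #|S|)%N -> 0 <= x ->
  (P [set w | (#|S|%:R * rate x ^+ t.+1 * Num.sqrt x * W S <=
               norm2 (z w - zS S w))%R]
   <= (3072 * t%:R * #|S|%:R * expR (- (x / 3072)))%:E)%E.
Proof.
move=> S0 x0; apply: tail_reduction => //.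
  rewrite -[X in measurable X]setTI; apply: measurable_fun_le => //.
  apply: measurable_norm2 => i j; rewrite (ord1 j).
  under eq_fun do rewrite mxE [X in _ + X]mxE.
  by apply: measurable_funB; [exact: mz|exact: mzS].
move=> x1 w h /= h'; have := le_trans h' h; apply/negP; rewrite -ltNge.
have r2 := rate2 x.
have p0 : 0 < #|S|%:R * Num.sqrt x * W S.
  apply: mulr_gt0; last exact: lt_le_trans ltr01 (W1 S).
  by rewrite mulr_gt0 ?ltr0n// sqrtr_gt0; lra.
have -> : #|S|%:R * rate x ^+ t.+1 * Num.sqrt x * W S =
   rate x ^+ t.+1 * (#|S|%:R * Num.sqrt x * W S) by ring.
by rewrite ltr_pM2r// ltr_eXn2l//; lra.
Qed.

(** Take [S = {k}]: the coordinate [k] of the leave-out iterate is bounded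
    deterministically by [left_out_growth], and [n^(-1/2) |z0|] is at most the
    sup norm of [z0]. *)
Lemma fixed_entry_tail (k : 'I_n) (x : R) : 0 <= x ->
  (P [set w | (rate x ^+ t.+1 * (1 + Num.sqrt x) * (1 + `|z0|) <= `|z w k 0|)%R]
   <= (3072 * t%:R * expR (- (x / 3072)))%:E)%E.
Proof.
move=> x0.
have S1 : #|[set k]%SET| = 1%N by rewrite cards1.
have := @tail_reduction [set k]%SET x; rewrite S1 mulr1; apply => //.
  rewrite -[X in measurable X]setTI; apply: measurable_fun_le => //.
  exact: measurableT_comp.
move=> x1 w h /= h'.
have r2 := rate2 x; have K2' := K2; have L2' := L2.
have s1 : 1 <= Num.sqrt x by rewrite -sqrtr1 ler_wsqrtr.
have zk : `|zS [set k]%SET w k 0| <= rate x ^+ t * (1 + `|z0|).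
  have kk : k \in [set k]%SET by rewrite inE.
  have := left_out_growth F z0 L1 lG (A w) kk (leqnn t).
  rewrite big_ord_recr/= => g.
  apply: (@le_trans _ _ ((2 * L) ^+ t * (1 + `|z0 k 0|))).
    apply: le_trans g; rewrite addrA lerDr addr_ge0// sumr_ge0//.
  apply: ler_pM => //.
  - by rewrite exprn_ge0//; lra.
  - rewrite lerXn2r ?nnegrE//; [lra|lra|].
    rewrite /rate; have := sqrtr_ge0 (x / n%:R); set s := Num.sqrt _ => s0.
    have -> : 3072 * K * L * (1 + s) = 2 * L * (1536 * K * (1 + s)) by ring.
    by rewrite ler_peMr; [|lra|nra].
  - by rewrite lerD2l entry_le_norm.
have dk : `|z w k 0 - zS [set k]%SET w k 0| <=
    rate x ^+ t * (Num.sqrt x * (1 + 2 * `|z0|)).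
  have := norm2_entry (z w - zS [set k]%SET w) k 0; rewrite !mxE => /le_trans.
  apply; apply: le_trans h _; rewrite mul1r ler_wpM2l ?exprn_ge0//; first by lra.
  rewrite ler_wpM2l ?sqrtr_ge0// /W -addrA lerD2l big_set1E mulr_natl mulr2n lerD//.
    by rewrite ge_max entry_le_norm normr_ge0.
  rewrite ler_pdivrMl; first exact: norm2_le_norm.
  by rewrite sqrtr_gt0 ltr0n.
have tri : `|z w k 0| <= `|z w k 0 - zS [set k]%SET w k 0| + `|zS [set k]%SET w k 0|.
  by rewrite -{1}(subrK (zS [set k]%SET w k 0) (z w k 0)) ler_normD.
have N0 : 0 <= `|z0| by [].
have p0 : 0 < rate x ^+ t by rewrite exprn_gt0//; lra.
move: h'; apply/negP; rewrite -ltNge exprSr.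
apply: le_lt_trans tri _; apply: le_lt_trans (lerD dk zk) _.
move: (rate x ^+ t) (rate x) p0 r2 (Num.sqrt x) `|z0| s1 N0.
move=> p r p0 r2 a b a1 b0.
rewrite -mulrDr -!mulrA ltr_pM2l//.
have h1 : a * (1 + 2 * b) + (1 + b) < 2 * ((1 + a) * (1 + b)) by nra.
have h2 : 2 * ((1 + a) * (1 + b)) <= r * ((1 + a) * (1 + b)).
  by apply: ler_wpM2r; [apply: mulr_ge0; lra|lra].
exact: lt_le_trans h1 h2.
Qed.

Lemma fixed_norm_tail (x : R) : 0 <= x ->
  (P [set w | (rate x ^+ t.+1 * (1 + Num.sqrt x) * (1 + `|z0|) <= `|z w|)%R]
   <= (n%:R * (3072 * t%:R * expR (- (x / 3072))))%:E)%E.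
Proof.
move=> x0; set thr := _ * _ * _.
have thr0 : 0 < thr.
  apply: mulr_gt0; last by rewrite ltr_pwDl.
  apply: mulr_gt0; last by rewrite ltr_pwDl ?sqrtr_ge0.
  by apply: exprn_gt0; apply: lt_trans (rate2 x).
pose B k := [set w | thr <= `|z w k 0|].
have mB k : measurable (B k).
  rewrite -[X in measurable X]setTI; apply: measurable_fun_le => //.
  exact: measurableT_comp.
have [mU PU] := union_bound (P := P) (A := [set: 'I_n]%SET) (F := B)
  (p := 3072 * t%:R * expR (- (x / 3072))) (fun k _ => mB k)
  (fun k _ => fixed_entry_tail k x0).
rewrite cardsT card_ord in PU; apply: le_trans PU.
have -> : [set w | (thr <= `|z w|)%R] = \bigcup_(i in [set` [set: 'I_n]%SET]) B i.
  apply/seteqP; split => [w /= tw|w [k _] /= h]; last first.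
    exact: le_trans h (entry_le_norm _ _).
  apply: contrapT => nex; move: tw; apply/negP; rewrite -ltNge.
  apply: norm_lt => // k; rewrite ltNge; apply/negP => h.
  by apply: nex; exists k => //=; rewrite inE.
exact: lexx.
Qed.

End FixedTails.

(** * Moments from tails *)

Section MomentOfTail.
Context {R : realType}.
Variable c : R.
Hypothesis c1 : 1 <= c.

Definition geom_ratio : R := expR (- (1 / (2 * c))).
(** The value of [expR (1 / 2c) * sum_(m >= 0) geom_ratio^m]. *)
Definition geom_mass : R := geom_ratio^-1 / (1 - geom_ratio).
Definition moment_const (p : R) : R := 32 * c ^+ 2 * p * geom_mass.

Lemma geom_ratio01 : 0 < geom_ratio < 1.
Proof.
have c1' := c1; rewrite expR_gt0/= expR_lt1 oppr_lt0 divr_gt0//; lra.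
Qed.

Lemma geom_mass_ge1 : 1 <= geom_mass.
Proof.
have /andP[r0 r1] := geom_ratio01.
rewrite /geom_mass -invfM invf_ge1.
  by move: geom_ratio r0 r1 => r *; nra.
by rewrite mulr_gt0// subr_gt0.
Qed.

Lemma moment_const_gt1 p : 1 <= p -> 1 < moment_const p.
Proof.
move=> p1; have c1' := c1; have g1 := geom_mass_ge1; rewrite /moment_const.
have : 1 <= c ^+ 2 by rewrite expr_ge1//; lra.
move: (c ^+ 2) geom_mass g1 => u g g1 u1.
have : 1 <= u * p by rewrite mulr_ege1.
move=> up; have : 1 <= u * p * g by rewrite mulr_ege1.
by rewrite -!mulrA; lra.
Qed.

Lemma geom_partial_sum (r : R) N : 0 < r < 1 ->
  \sum_(0 <= m < N) r ^+ m <= (1 - r)^-1.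
Proof.
move=> /andP[r0 r1]; rewrite -[leRHS]mul1r ler_pdivlMr ?subr_gt0//.
suff -> : (\sum_(0 <= m < N) r ^+ m) * (1 - r) = 1 - r ^+ N.
  by rewrite gerBl exprn_ge0// ltW.
elim: N => [|N IH]; first by rewrite big_geq// mul0r expr0 subrr.
by rewrite big_nat_recr//= mulrDl IH exprSr; ring.
Qed.

Lemma expR_powR (y p : R) : expR y `^ p = expR (y * p).
Proof. by rewrite /powR gt_eqF ?expR_gt0// expRK mulrC. Qed.

(** [u <= a * expR (u / a)] trades the polynomial growth of the [m]-th level
    for half of the exponential decay of its probability. *)
Lemma level_le (t : nat) (b p u : R) : 0 <= b -> 1 <= p -> 1 <= u ->
  (b * (1 + Num.sqrt u) ^+ t.+2) `^ p <=
  (b * (8 * c * p * t.+1%:R) ^+ t.+1) `^ p * expR (u / (2 * c)).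
Proof.
move=> b0 p1 u1; have c1' := c1.
have t1 : 1 <= t.+1%:R :> R by rewrite ler1n.
pose a := 2 * c * p * t.+1%:R.
have a0 : 0 < a by rewrite /a !mulr_gt0//; lra.
have s1 : 1 <= Num.sqrt u by rewrite -sqrtr1 ler_wsqrtr.
have su : Num.sqrt u ^+ 2 = u by rewrite sqr_sqrtr//; lra.
have ua : u <= a * expR (u / a).
  have h := expR_ge1Dx (u / a).
  apply: (@le_trans _ _ (a * (u / a))); first by rewrite mulrCA mulfV ?mulr1// gt_eqF.
  by rewrite ler_pM2l//; lra.
have h4 : (1 + Num.sqrt u) ^+ 2 <= 4 * u.
  have -> : 4 * u = 4 * Num.sqrt u ^+ 2 by rewrite su.
  by move: (Num.sqrt u) s1 => s s1; nra.
have base : (1 + Num.sqrt u) ^+ t.+2 <= (4 * a) ^+ t.+1 * expR (u / (2 * c) / p).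
  apply: (@le_trans _ _ ((1 + Num.sqrt u) ^+ (2 * t.+1))).
    by rewrite ler_weXn2l//; [lra|rewrite mul2n -addnn addSn ltnS leq_addl].
  rewrite exprM; apply: (@le_trans _ _ ((4 * (a * expR (u / a))) ^+ t.+1)).
    apply: lerXn2r; rewrite ?nnegrE ?sqr_ge0//.
      by apply: mulr_ge0 => //; apply: mulr_ge0; [exact: ltW|exact: expR_ge0].
    by apply: le_trans h4 _; lra.
  rewrite mulrA exprMn ler_wpM2l//.
    by rewrite exprn_ge0// mulr_ge0// ltW.
  rewrite -expRM_natl ler_expR le_eqVlt; apply/orP; left; apply/eqP.
  by rewrite /a; field; rewrite !gt_eqF//; lra.
have B0 : 0 <= b * (8 * c * p * t.+1%:R) ^+ t.+1.
  by rewrite mulr_ge0// exprn_ge0// !mulr_ge0//; lra.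
apply: (@le_trans _ _ ((b * (8 * c * p * t.+1%:R) ^+ t.+1 *
    expR (u / (2 * c) / p)) `^ p)).
  apply: ge0_ler_powR; rewrite ?nnegrE.
  - lra.
  - by rewrite mulr_ge0// exprn_ge0// addr_ge0.
  - by rewrite mulr_ge0// expR_ge0.
  rewrite -mulrA ler_wpM2l//.
  by rewrite (_ : 8 * c * p * t.+1%:R = 4 * a)// /a; ring.
rewrite powRM ?expR_ge0// expR_powR divfK// gt_eqF//; lra.
Qed.

Context {d : measure_display} {T : measurableType d}.
Variable P : probability T R.

(** [W^p] is dominated by the sum over [m] of [g (m+1)^p] on the event
    [g m <= W], where [g m = b (1 + sqrt m)^(t+2)].  Integrating term by term and
    using [level_le] leaves a geometric series; its sum, being at least 1, is
    at most its own [p]-th power and can be put inside the norm. *)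
Lemma moment_of_tail (t : nat) (W : T -> R) (b p : R) :
  (0 < t)%N -> 0 < b -> 1 <= p -> measurable_fun setT W -> (forall w, 0 <= W w) ->
  (forall m : nat, (P [set w | (b * (1 + Num.sqrt m%:R) ^+ t.+2 <= W w)%R] <=
     (c * t%:R * expR (- (m%:R / c)))%:E)%E) ->
  (\int[P]_w (W w `^ p)%:E <=
     ((b * (moment_const p * t%:R) ^+ t.+1) `^ p)%:E)%E.
Proof.
move=> t0 b0 p1 mW W0 tail; have c1' := c1.
have t1 : 1 <= t%:R :> R by rewrite ler1n.
pose g (m : nat) := b * (1 + Num.sqrt m%:R) ^+ t.+2.
(* [E 0] is everything, in order to cover the values of [W] below [g 1]. *)
pose E (m : nat) : set T := if m is 0%N then setT else [set w | g m <= W w].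
have mE m : measurable (E m).
  case: m => [|m] //=; rewrite -[X in measurable X]setTI.
  exact: measurable_fun_le.
have PE m : (P (E m) <= (c * t%:R * expR (- (m%:R / c)))%:E)%E.
  case: m => [|m]; last exact: tail.
  rewrite mul0r oppr0 expR0 mulr1; apply: le_trans (probability_le1 _ _) _ => //.
  by rewrite lee_fin mulr_ege1.
pose f m w : \bar R := (g m.+1 `^ p * \1_(E m) w)%:E.
have f0 m w : (0 <= f m w)%E by rewrite lee_fin mulr_ge0 ?powR_ge0.
have mf m : measurable_fun setT (f m).
  by apply/measurable_EFinP/measurable_funM => //; exact: measurable_indic.
have g0 m : 0 <= g m.
  by rewrite mulr_ge0 ?(ltW b0)// exprn_ge0// addr_ge0 ?sqrtr_ge0.
have gW w : exists m, W w < g m.+1.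
  pose m := Num.truncn (W w / b); exists m.
  apply: (@lt_le_trans _ _ (b * m.+1%:R)).
    by rewrite -ltr_pdivrMl// mulrC truncnS_gt.
  rewrite ler_wpM2l ?(ltW b0)//.
  have s0 : 0 <= Num.sqrt (m.+1%:R : R) by exact: sqrtr_ge0.
  apply: (@le_trans _ _ ((1 + Num.sqrt m.+1%:R) ^+ 2)).
    have := sqr_sqrtr (ler0n R m.+1); move: (Num.sqrt _) s0 => s s0 <-; nra.
  by rewrite ler_weXn2l// lerDl.
have pt w : ((W w `^ p)%:E <= \sum_(0 <= m <oo) f m w)%E.
  have [m Wm min] := ex_minnP (gW w).
  have wE : E m w.
    case: m Wm min => //= m _ min; rewrite leNgt; apply/negP => h.
    by have := min m h; rewrite ltnn.
  apply: le_trans (nneseries_lim_ge m.+1 (fun k _ _ => f0 k w)).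
  rewrite big_nat_recr//= -[leLHS]add0e leeD//; first by apply: sume_ge0 => k _.
  rewrite /f indicE mem_set// mulr1 lee_fin ge0_ler_powR ?nnegrE//; last exact: ltW.
  by lra.
set B := (b * (8 * c * p * t.+1%:R) ^+ t.+1).
have /andP[r0 r1] := geom_ratio01.
pose V := c * t%:R * geom_ratio^-1.
have V0 : 0 <= V by rewrite !mulr_ge0 ?invr_ge0 ?(ltW r0)//; lra.
have intf m : (\int[P]_w f m w <= (B `^ p * V * geom_ratio ^+ m)%:E)%E.
  rewrite /f; under eq_integral do rewrite EFinM.
  rewrite ge0_integralZl_EFin ?powR_ge0//; last first.
    by apply/measurable_EFinP; apply: measurable_indic.
  rewrite integral_indic// setIT.
  apply: (@le_trans _ _ ((g m.+1 `^ p)%:E * (c * t%:R * expR (- (m%:R / c)))%:E)%E).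
    by apply: lee_wpmul2l; [rewrite lee_fin powR_ge0|exact: PE].
  rewrite -EFinM lee_fin.
  have u1 : 1 <= m.+1%:R :> R by rewrite ler1n.
  apply: (@le_trans _ _ (B `^ p * expR (m.+1%:R / (2 * c)) *
      (c * t%:R * expR (- (m%:R / c))))).
    apply: ler_wpM2r; first by rewrite !mulr_ge0 ?expR_ge0//; lra.
    by apply: level_le => //; exact: ltW.
  rewrite /V; set e1 := expR _; set e2 := expR _; set r := geom_ratio.
  have -> : B `^ p * e1 * (c * t%:R * e2) = B `^ p * (c * t%:R) * (e1 * e2) by ring.
  have -> : B `^ p * (c * t%:R * r^-1) * r ^+ m =
     B `^ p * (c * t%:R) * (r^-1 * r ^+ m) by ring.
  rewrite ler_wpM2l//.
    by apply: mulr_ge0; [exact: powR_ge0|rewrite mulr_ge0//; lra].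
  rewrite /r /e1 /e2 /geom_ratio -expRN opprK -expRM_natl -!expRD ler_expR -natr1.
  by rewrite le_eqVlt; apply/orP; left; apply/eqP; field; lra.
have p0 : 0 <= p by lra.
apply: (@le_trans _ _ (\int[P]_w \sum_(0 <= m <oo) f m w)%E).
  apply: ge0_le_integral => //.
  - by move=> w _; rewrite lee_fin powR_ge0.
  - by apply/measurable_EFinP; exact: (measurableT_comp (measurable_powR p)).
  - exact: ge0_emeasurable_sum.
rewrite integral_nneseries//.
apply: (@le_trans _ _ (B `^ p * V / (1 - geom_ratio))%:E).
  apply: lime_le; first by apply: is_cvg_nneseries => m _ _; exact: integral_ge0.
  apply: nearW => N; apply: le_trans (lee_sum _ (fun m _ => intf m)) _.
  rewrite sumEFin lee_fin -mulr_sumr; apply: ler_wpM2l.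
    by apply: mulr_ge0; rewrite ?powR_ge0.
  by apply: geom_partial_sum; rewrite r0.
rewrite lee_fin.
have VE : V / (1 - geom_ratio) = c * t%:R * geom_mass by rewrite /V /geom_mass; ring.
rewrite -mulrA VE.
have g1 := geom_mass_ge1.
have cg1 : 1 <= c * geom_mass by rewrite mulr_ege1.
have V1 : 1 <= c * t%:R * geom_mass by rewrite mulrAC mulr_ege1.
have B0 : 0 <= B by rewrite mulr_ge0 ?(ltW b0)// exprn_ge0// !mulr_ge0//; lra.
apply: (@le_trans _ _ (B `^ p * (c * t%:R * geom_mass) `^ p)).
  by rewrite ler_wpM2l ?powR_ge0// le1r_powR.
rewrite -powRM//; last by lra.
apply: ge0_ler_powR; rewrite ?nnegrE//.
- by rewrite mulr_ge0//; lra.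
- by rewrite mulr_ge0 ?(ltW b0)// exprn_ge0// mulr_ge0 ?(ltW (lt_trans ltr01 (moment_const_gt1 _))).
rewrite /B -mulrA ler_wpM2l ?(ltW b0)//.
have -> : moment_const p * t%:R = (16 * c * p * t%:R) * (2 * (c * geom_mass)).
  by rewrite /moment_const; ring.
rewrite [leRHS]exprMn; apply: ler_pM.
- by rewrite exprn_ge0// !mulr_ge0//; lra.
- by lra.
- apply: lerXn2r; rewrite ?nnegrE.
    by rewrite !mulr_ge0//; lra.
    by rewrite !mulr_ge0//; lra.
  rewrite -natr1; have : 0 <= c * p by rewrite mulr_ge0//; lra.
  by move: t1; set u := t%:R; rewrite -!(mulrA _ c p); nra.
have -> : c * t%:R * geom_mass = t%:R * (c * geom_mass) by ring.
rewrite [leRHS]exprMn; apply: ler_pM; [by []|by lra| |].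
  by rewrite -natrX ler_nat (leq_trans (ltnW (ltn_expl t (isT : (1 < 2)%N))))// leq_exp2l.
by rewrite exprS ler_peMr//; [lra|rewrite exprn_ege1].
Qed.

End MomentOfTail.

Lemma measurable_bigmax d (T : measurableType d) (R : realType) (I : Type)
    (s : seq I) (Q : pred I) (h : I -> T -> R) :
  (forall i, measurable_fun setT (h i)) ->
  measurable_fun setT (fun w => \big[Num.max/0]_(i <- s | Q i) h i w).
Proof.
move=> mh; elim: s => [|i s IH].
  by under eq_fun do rewrite big_nil; exact: measurable_cst.
under eq_fun do rewrite big_cons.
by case: (Q i) => //; exact: measurable_maxr.
Qed.

Lemma measurable_mx_norm d (T : measurableType d) (R : realType) (n : nat)
    (v : T -> 'cV[R]_n) : (forall i, measurable_fun setT (fun w => v w i 0)) ->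
  measurable_fun setT (fun w => `|v w|).
Proof.
move=> mv; rewrite /Num.norm /=; under eq_fun do rewrite mx_normrE.
apply: measurable_bigmax => -[i j] /=; rewrite (ord1 j).
exact: measurableT_comp.
Qed.

Section MomentConstant.
Context {R : realType}.

Lemma ln2_ge_half : 1 / 2 <= ln 2 :> R.
Proof.
rewrite -ler_expR lnK ?posrE//; apply: le_trans (expR_le_quad _) _; lra.
Qed.

Lemma ln_le_id (x : R) : 0 < x -> ln x <= x.
Proof.
move=> x0; rewrite -ler_expR lnK ?posrE//.
by have := expR_ge1Dx x; lra.
Qed.

Lemma sqrtD_le (a b : R) : 0 <= a -> 0 <= b ->
  Num.sqrt (a + b) <= Num.sqrt a + Num.sqrt b.
Proof.
move=> a0 b0; rewrite -(@ler_pXn2r _ 2)// ?nnegrE ?addr_ge0 ?sqrtr_ge0//.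
rewrite sqrrD !sqr_sqrtr ?addr_ge0//.
have : 0 <= Num.sqrt a * Num.sqrt b by rewrite mulr_ge0 ?sqrtr_ge0.
by rewrite -mulr_natl; lra.
Qed.

Lemma sqrt_shift (m c l : R) : 0 <= m -> 0 <= c -> 0 <= l ->
  Num.sqrt (m + c * l) <= Num.sqrt m + Num.sqrt c * Num.sqrt l.
Proof.
by move=> m0 c0 l0; rewrite -sqrtrM//; apply: sqrtD_le => //; exact: mulr_ge0.
Qed.

Lemma sqrt_shift_div (m c l N : R) : 0 <= m -> 0 <= c -> 0 <= l -> 1 <= N ->
  l <= N -> Num.sqrt ((m + c * l) / N) <= Num.sqrt m + Num.sqrt c.
Proof.
move=> m0 c0 l0 N1 lN; apply: (@le_trans _ _ (Num.sqrt (m + c))); last first.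
  exact: sqrtD_le.
apply: ler_wsqrtr; rewrite ler_pdivrMr; last by lra.
have : m <= m * N by rewrite ler_peMr.
have : c * l <= c * N by rewrite ler_wpM2l.
by rewrite mulrDl; lra.
Qed.

(** The factor [(1 + sqrt c)^2 * 12] is only consumed by the supremum, where
    it pays for the shift by [c ln n] and for [1 + sqrt (ln n)]. *)
Definition final_const (c p : R) : R :=
  c * ((1 + Num.sqrt c) ^+ 2 * 12) * moment_const c p.

Lemma final_const_gt1 c p : 1 <= c -> 1 <= p -> 1 < final_const c p.
Proof.
move=> c1 p1; have := moment_const_gt1 c1 p1.
rewrite /final_const; move: (moment_const _ _) => u u1.
have := sqrtr_ge0 c; move: (Num.sqrt c) => s s0.
have : 1 <= (1 + s) ^+ 2 by rewrite expr_ge1//; lra.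
move: ((1 + s) ^+ 2) => v v1.
have : 12 <= c * (v * 12) by nra.
nra.
Qed.

End MomentConstant.

Section MomentsFromTails.
Context {d : measure_display} {T : measurableType d} {R : realType}.
Variable P : probability T R.
Variables (n t : nat) (c K L Z p : R) (W : T -> R).
Hypotheses (c1 : 1 <= c) (K0 : 0 < K) (L0 : 0 < L) (Z0 : 0 < Z) (p1 : 1 <= p).
Hypotheses (n2 : (2 <= n)%N) (t0 : (0 < t)%N).
Hypotheses (mW : measurable_fun setT W) (W0 : forall w, 0 <= W w).

Let level x := (c * K * L * (1 + Num.sqrt (x / n%:R))) ^+ t.+1
  * (1 + Num.sqrt x) * Z.

Let mc := moment_const c p.
Let mc1 : 1 < mc. Proof. exact: moment_const_gt1. Qed.
Let t1 : 1 <= t%:R :> R. Proof. by rewrite ler1n. Qed.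
Let n0 : (0 < n)%N. Proof. exact: leq_trans n2. Qed.
Let n1 : 1 <= n%:R :> R. Proof. by rewrite ler1n. Qed.
Let c0 : 0 < c. Proof. exact: lt_le_trans ltr01 c1. Qed.

Let KLp : 0 < c * K * L.
Proof. by rewrite !mulr_gt0. Qed.

Let mt0 : 0 <= mc * t%:R.
Proof. by rewrite mulr_ge0// ltW// (lt_trans ltr01 mc1). Qed.

Let final_constE : final_const c p * t%:R * K * L =
  (c * K * L) * ((1 + Num.sqrt c) ^+ 2 * 12) * (mc * t%:R).
Proof. by rewrite /final_const -/mc; ring. Qed.

Let le_level x y : y >= level x ->
  (P [set w | (y <= W w)%R] <= P [set w | (level x <= W w)%R])%E.
Proof.
move=> yx; apply: le_measure; rewrite ?inE.
- by rewrite -[X in measurable X]setTI; apply: measurable_fun_le.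
- by rewrite -[X in measurable X]setTI; apply: measurable_fun_le.
by move=> w /=; apply: le_trans.
Qed.

Lemma moment_from_tail :
  (forall x, 0 <= x -> (P [set w | (level x <= W w)%R] <=
    (c * t%:R * expR (- (x / c)))%:E)%E) ->
  (\int[P]_w (W w `^ p)%:E <=
   (((final_const c p * t%:R * K * L) ^+ t.+1 * Z) `^ p)%:E)%E.
Proof.
move=> tail.
pose b := (c * K * L) ^+ t.+1 * Z.
have b0 : 0 < b by rewrite mulr_gt0// exprn_gt0.
apply: le_trans (moment_of_tail c1 t0 b0 p1 mW W0 _) _.
  move=> m; apply: le_trans (tail _ (ler0n _ m)); apply: le_level.
  have s0 := sqrtr_ge0 (m%:R : R).
  have e (u y v : R) : u ^+ t.+1 * v * y ^+ t.+2 = (u * y) ^+ t.+1 * y * v.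
    by rewrite exprMn [y ^+ t.+2]exprS; ring.
  rewrite /b e /level ler_wpM2r ?(ltW Z0)// ler_wpM2r ?addr_ge0//.
  apply: lerXn2r; rewrite ?nnegrE ?mulr_ge0 ?(ltW c0) ?(ltW K0) ?(ltW L0)
    ?addr_ge0 ?sqrtr_ge0//.
  apply: ler_wpM2l; first exact: ltW.
  by rewrite lerD2l ler_wsqrtr// ler_pdivrMr ?ltr0n// ler_peMr.
have s0 := sqrtr_ge0 c.
have D1 : 1 <= (1 + Num.sqrt c) ^+ 2 * 12.
  by move: (Num.sqrt c) s0 => s s0; nra.
have D0 := le_trans ler01 D1.
have u0 := ltW KLp.
rewrite final_constE /b; move: (c * K * L) u0 (mc * t%:R) mt0 => u u0 v v0.
move: (_ * 12) D1 D0 => D D1 D0.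
have -> : u ^+ t.+1 * Z * v ^+ t.+1 = (u * v) ^+ t.+1 * Z.
  by rewrite exprMn; ring.
have z0 := ltW Z0.
rewrite lee_fin; apply: ge0_ler_powR; rewrite ?nnegrE ?mulr_ge0 ?exprn_ge0 ?mulr_ge0//.
  exact: le_trans ler01 p1.
apply: ler_wpM2r => //; apply: lerXn2r; rewrite ?nnegrE ?mulr_ge0//.
by apply: ler_wpM2r => //; rewrite ler_peMr.
Qed.

(** At [x = m + c ln n] the factor [n] in the tail cancels [expR (- ln n)], while
    the level grows by no more than [(1 + sqrt c)^(t+2) (1 + sqrt (ln n))].  The
    last factor is at most [12^(t+1) (ln n)^(2t)], because [ln n >= 1/2]. *)
Lemma log_moment_from_tail :
  (forall x, 0 <= x -> (P [set w | (level x <= W w)%R] <=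
    (n%:R * (c * t%:R * expR (- (x / c))))%:E)%E) ->
  (\int[P]_w (W w `^ p)%:E <=
   (((final_const c p * t%:R * K * L) ^+ t.+1 * Z * ln n%:R ^+ (2 * t)) `^ p)%:E)%E.
Proof.
move=> tail; have n1' := n1.
set l := ln n%:R.
have l_half : 1 / 2 <= l.
  by apply: le_trans ln2_ge_half _; rewrite ler_ln ?posrE ?ltr0n// ler_nat.
have l0 : 0 <= l by lra.
have ln_n : l <= n%:R by apply: ln_le_id; rewrite ltr0n.
set q := Num.sqrt c.
have q0 : 0 <= q by exact: sqrtr_ge0.
set sl := Num.sqrt l.
have sl0 : 0 <= sl by exact: sqrtr_ge0.
have c0' := ltW c0.
have z0 := ltW Z0.
pose b := (c * K * L) ^+ t.+1 * (1 + q) ^+ t.+2 * (1 + sl) * Z.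
have b0 : 0 < b.
  by apply: mulr_gt0 => //; apply: mulr_gt0; [apply: mulr_gt0;
    apply: exprn_gt0|]; rewrite // ltr_pwDl.
apply: le_trans (moment_of_tail c1 t0 b0 p1 mW W0 _) _.
  move=> m; have m0 : 0 <= m%:R :> R by [].
  have x0 : 0 <= m%:R + c * l by rewrite addr_ge0// mulr_ge0.
  apply: (@le_trans _ _ (n%:R * (c * t%:R *
      expR (- ((m%:R + c * l) / c))))%:E); last first.
    have -> : - ((m%:R + c * l) / c) = - (m%:R / c) + - l.
      by field; rewrite gt_eqF.
    rewrite expRD (expRN l) lnK ?posrE ?ltr0n//.
    rewrite lee_fin le_eqVlt; apply/orP; left; apply/eqP; field.
    by rewrite pnatr_eq0 -lt0n.
  apply: le_trans (tail _ x0); apply: le_level.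
  set sm := Num.sqrt (m%:R : R).
  have sm0 : 0 <= sm by exact: sqrtr_ge0.
  have e (u a y e v : R) : u ^+ t.+1 * a ^+ t.+2 * e * v * y ^+ t.+2 =
      (u * (a * y)) ^+ t.+1 * (a * e * y) * v.
    by rewrite !exprMn [y ^+ t.+2]exprS [a ^+ t.+2]exprS; ring.
  rewrite /b e /level.
  have h1 := sqrt_shift_div m0 c0' l0 n1 ln_n.
  have h2 := sqrt_shift m0 c0' l0.
  rewrite -/sm -/q in h1; rewrite -/sm -/q -/sl in h2.
  have h10 := sqrtr_ge0 ((m%:R + c * l) / n%:R).
  have h20 := sqrtr_ge0 (m%:R + c * l).
  move: (Num.sqrt (_ / _)) (Num.sqrt (m%:R + _)) h1 h2 h10 h20 => r1 r2 h1 h2 h10 h20.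
  rewrite ler_wpM2r//; apply: ler_pM.
  + by rewrite exprn_ge0// mulr_ge0 ?(ltW KLp)// addr_ge0.
  + by rewrite addr_ge0.
  + apply: lerXn2r; rewrite ?nnegrE ?mulr_ge0 ?(ltW K0) ?(ltW L0) ?addr_ge0//.
    by apply: ler_wpM2l; [exact: ltW|nra].
  + have y1 : 1 + q * sl <= (1 + q) * (1 + sl) by lra.
    have y0 : 0 <= q * sl by rewrite mulr_ge0.
    apply: (@le_trans _ _ (1 + (sm + q * sl))); first by lra.
    by move: (q * sl) ((1 + q) * (1 + sl)) y1 y0 => y Y y1 y0; nra.
have hl : 1 + sl <= 12 ^+ t.+1 * l ^+ (2 * t).
  have lsl : l = sl ^+ 2 by rewrite sqr_sqrtr.
  have h6 : 1 + sl <= 12 * l by rewrite lsl in l_half *; nra.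
  have h3 : 1 <= (2 * l) ^+ (2 * t).-1 by rewrite exprn_ege1//; lra.
  have tt : (2 * t = (2 * t).-1.+1)%N by rewrite prednK// muln_gt0.
  apply: (@le_trans _ _ (6 * (2 * l) ^+ (2 * t))).
    rewrite tt exprS; nra.
  rewrite exprMn mulrA ler_wpM2r ?exprn_ge0// exprM [12 ^+ _]exprS.
  have : (2 ^+ 2) ^+ t <= 12 ^+ t :> R by apply: lerXn2r; rewrite ?nnegrE//; lra.
  have : 0 <= 12 ^+ t :> R by rewrite exprn_ge0.
  by move: ((2 ^+ 2) ^+ t) (12 ^+ t) => x y; lra.
have hq : (1 + q) ^+ t.+2 <= ((1 + q) ^+ 2) ^+ t.+1.
  rewrite -exprM ler_weXn2l//; first by lra.
  by rewrite mul2n -addnn addSn ltnS leq_addl.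
have u0 := ltW KLp.
rewrite final_constE /b -/q; move: (c * K * L) u0 (mc * t%:R) mt0 => u u0 v v0.
have -> : u ^+ t.+1 * (1 + q) ^+ t.+2 * (1 + sl) * Z * v ^+ t.+1 =
  (u ^+ t.+1 * v ^+ t.+1 * Z) * ((1 + q) ^+ t.+2 * (1 + sl)) by ring.
have -> : (u * ((1 + q) ^+ 2 * 12) * v) ^+ t.+1 * Z * l ^+ (2 * t) =
  (u ^+ t.+1 * v ^+ t.+1 * Z) *
    (((1 + q) ^+ 2) ^+ t.+1 * (12 ^+ t.+1 * l ^+ (2 * t))).
  by rewrite !(exprMn t.+1); ring.
have Q0 : 0 <= u ^+ t.+1 * v ^+ t.+1 * Z by rewrite !mulr_ge0 ?exprn_ge0.
have q1 : 0 <= (1 + q) ^+ t.+2 by rewrite exprn_ge0// addr_ge0.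
have q2 : 0 <= ((1 + q) ^+ 2) ^+ t.+1 by exact: le_trans q1 hq.
have q3 : 0 <= 1 + sl by rewrite addr_ge0.
have q4 : 0 <= 12 ^+ t.+1 * l ^+ (2 * t) by exact: le_trans q3 hl.
rewrite lee_fin; apply: ge0_ler_powR; rewrite ?nnegrE.
- exact: le_trans ler01 p1.
- exact: mulr_ge0 Q0 (mulr_ge0 q1 q3).
- exact: mulr_ge0 Q0 (mulr_ge0 q2 q4).
by apply: ler_wpM2l => //; exact: ler_pM.
Qed.

End MomentsFromTails.

(** * Conditional expectation given an independent initialization *)

Section ConditionalExpectation.
Context {d : measure_display} {T : measurableType d} {R : realType}.
Variable P : probability T R.
Variable Gz : set (set T).
Let Tz := g_sigma_algebraType Gz.
Hypothesis subG : <<s Gz >> `<=` (@measurable _ T).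

Let mid : measurable_fun setT (fun w : T => (w : Tz)).
Proof. by move=> _ B mB; rewrite setTI; exact: subG. Qed.

Let version_measurable (X Y : T -> \bar R) :
  cond_exp_version P <<s Gz >> X Y -> measurable_fun setT (Y : Tz -> \bar R).
Proof. by move=> [_ mY _] _ B mB; rewrite setTI; exact: mY. Qed.

(** On the set where [Y' < Y] and [Y'] is bounded, which belongs to the
    sigma-algebra, both versions have the same finite integral; hence that set
    is negligible. *)
Lemma cond_exp_version_le (X Y Y' : T -> \bar R) :
  cond_exp_version P <<s Gz >> X Y -> cond_exp_version P <<s Gz >> X Y' ->
  (forall w, (Y' w < +oo)%E) -> {ae P, forall w, (Y w <= Y' w)%E}.
Proof.
move=> vY vY' fY'.
have mY := version_measurable vY; have mY' := version_measurable vY'.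
have [Y0 _ intY] := vY; have [Y'0 _ intY'] := vY'.
have mYT : measurable_fun setT Y by apply: (measurableT_comp mY); exact: mid.
have mY'T : measurable_fun setT Y' by apply: (measurableT_comp mY'); exact: mid.
pose B (N : nat) : set T := [set w | (Y' w < Y w)%E] `&` [set w | (Y' w <= N%:R%:E)%E].
have GB N : <<s Gz >> (B N).
  have mlt : measurable ([set w | (Y' w < Y w)%E] : set Tz).
    by rewrite -[X in measurable X]setTI; apply: measurable_lte.
  have mle : measurable ([set w | (Y' w <= N%:R%:E)%E] : set Tz).
    by rewrite -[X in measurable X]setTI; apply: measurable_lee.
  exact: (measurableI _ _ mlt mle).
have fin w : Y' w \is a fin_num by rewrite ge0_fin_numE.
have nB N : P.-negligible (B N).
  have mB := subG (GB N).
  pose Dl w := (Y w - Y' w)%E.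
  have mDl : measurable_fun (B N) Dl.
    by apply: emeasurable_funB; exact: measurable_funTS.
  have Dl0 w : B N w -> (0 <= Dl w)%E.
    by move=> [/= h _]; rewrite sube_ge0 ?fin// ltW.
  have eqY : (\int[P]_(w in B N) Y w =
      \int[P]_(w in B N) Y' w + \int[P]_(w in B N) Dl w)%E.
    rewrite -ge0_integralD//; last exact: measurable_funTS.
    by apply: eq_integral => w _; rewrite /Dl addeC subeK.
  have finI : (\int[P]_(w in B N) Y' w)%E \is a fin_num.
    rewrite ge0_fin_numE; last by apply: integral_ge0.
    apply: (@le_lt_trans _ _ (\int[P]_(w in B N) (cst N%:R%:E) w)%E).
      apply: ge0_le_integral => //; first exact: measurable_funTS.
      by move=> w [].
    by rewrite integral_cst// ltey_eq fin_numM// fin_num_measure.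
  have : (\int[P]_(w in B N) `|Dl w| = 0)%E.
    rewrite (eq_integral Dl); last first.
      by move=> w; rewrite inE => Bw; rewrite gee0_abs// Dl0.
    move: eqY; rewrite intY// intY'// -(intY' _ (GB N)) => /esym/eqP.
    rewrite -[eqbRHS]adde0 => /eqP h.
    have := congr1 (fun y => y - \int[P]_(w in B N) Y' w)%E h.
    by rewrite adde0 subee// addeAC subee// add0e.
  move=> /(ae_eq_integral_abs _ mB mDl); apply: negligibleS => w Bw /= h.
  have /= lt := Bw.1; have := h Bw; rewrite /Dl => e.
  by move: lt; rewrite -sube_gt0 e ltxx.
apply: negligibleS (negligible_bigcup nB) => w /= /negP; rewrite -ltNge => h.
have [N hN] : exists N : nat, (Y' w <= N%:R%:E)%E.
  exists (Num.truncn (fine (Y' w))).+1.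
  by rewrite -[leLHS](fineK (fin w)) lee_fin ltW// truncnS_gt.
by exists N.
Qed.

Context {d1 : measure_display} {T1 : measurableType d1}.
Variable U : T -> T1.
Hypothesis mU : measurable_fun setT U.
Hypothesis indU : forall B C, measurable B -> <<s Gz >> C ->
  P (U @^-1` B `&` C) = (P (U @^-1` B) * P C)%E.
Variable f : T1 * Tz -> \bar R.
Hypotheses (mf : measurable_fun setT f) (f0 : forall z, (0 <= f z)%E).

(** Freezing: conditionally on the sigma-algebra that [U] is independent of,
    the second argument may be treated as a constant. *)
Lemma freezing_version : cond_exp_version P <<s Gz >>
  (fun w => f (U w, w)) (fun y => \int[P]_w f (U w, y))%E.
Proof.
split.
- by move=> w; exact: integral_ge0.
- move=> B mB; rewrite -[X in <<s Gz >> X]setTI.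
  exact: (measurable_section_integral P mU mf f0 measurableT mB).
move=> B GB; rewrite integral_mkcond [RHS]integral_mkcond.
pose fB := f \_ ([set: T1] `*` (B : set Tz)).
have mfB : measurable_fun setT fB.
  apply/(measurable_restrictT _ _).1.
    by apply: measurableX.
  exact: measurable_funTS.
have fB0 z : (0 <= fB z)%E by rewrite /fB patchE; case: ifP.
transitivity (\int[P]_w fB (U w, w))%E; last first.
  apply: eq_integral => w _; rewrite /fB !patchE.
  by rewrite in_setX in_setT.
rewrite (integral_indep (P := P) mU mid mfB fB0)//.
apply: eq_integral => w _; rewrite /fB patchE; case: ifPn => wB.
  by apply: eq_integral => w' _; rewrite patchE in_setX in_setT wB.
rewrite integral0_eq// => w' _; rewrite patchE in_setX in_setT.
by rewrite (negbTE wB).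
Qed.

(** The frozen integral shows that a version exists, so [cond_exp] is one, and
    then it is almost surely below the frozen integral. *)
Lemma cond_exp_le (X : T -> \bar R) (b : T -> R) :
  (forall w, X w = f (U w, w)) ->
  (forall y, (\int[P]_w f (U w, y) <= (b y)%:E)%E) ->
  {ae P, forall w, (0 <= cond_exp P <<s Gz >> X w <= (b w)%:E)%E}.
Proof.
move=> XE fb.
have -> : X = (fun w => f (U w, w)) by apply/funext.
have v' := freezing_version.
have v : cond_exp_version P <<s Gz >> (fun w => f (U w, w))
    (cond_exp P <<s Gz >> (fun w => f (U w, w))).
  by apply: xgetPex; exists (fun y => \int[P]_w f (U w, y))%E.
apply: negligibleS (cond_exp_version_le v v' _) => [w /= h hb|w].
  apply: h; case: v => v0 _ _; rewrite v0/=.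
  exact: le_trans hb (fb w).
by apply: le_lt_trans (fb w) _; rewrite ltry.
Qed.

End ConditionalExpectation.

Section RandomMatrixSigma.
Context {d : measure_display} {T : measurableType d} {R : realType}.

Definition mx_gen {m n : nat} (X : T -> 'M[R]_(m, n)) : set (set T) :=
  \bigcup_(ij in [set: 'I_m * 'I_n])
    preimage_set_system setT (fun w => X w ij.1 ij.2) measurable.

Lemma mx_gen_measurable m n (X : T -> 'M[R]_(m, n)) :
  (forall i j, measurable_fun setT (fun w => X w i j)) ->
  <<s mx_gen X >> `<=` (@measurable _ T).
Proof.
move=> mX; apply: smallest_sub; first exact: sigma_algebra_measurable.
by move=> _ [[i j] _] [B mB <-]; exact: mX.
Qed.

Lemma measurable_mx_gen m n (X : T -> 'M[R]_(m, n)) i j :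
  measurable_fun setT
    ((fun w => X w i j) : g_sigma_algebraType (mx_gen X) -> R).
Proof.
move=> _ B mB; apply: sub_sigma_algebra.
by exists (i, j) => //; exists B.
Qed.

Variables (P : probability T R) (n : nat) (A : T -> 'M[R]_n) (z0 : T -> 'cV[R]_n).
Hypothesis mA : forall i j, measurable_fun setT (fun w => A w i j).
Hypothesis mz0 : forall i, measurable_fun setT (fun w => z0 w i 0).
Hypothesis indAz : independent_sigma P (sigma_mx A) (sigma_mx z0).

(** The measurability of [phi] is required after composition with arbitrary
    measurable matrices and vectors; it is used on the product of the two
    generated sigma-algebras. *)
Lemma cond_exp_frozen_le (phi : 'M[R]_n -> 'cV[R]_n -> R) (b : 'cV[R]_n -> R) :
  (forall d' (T' : measurableType d') (A' : T' -> 'M[R]_n) (z' : T' -> 'cV[R]_n),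
    (forall i j, measurable_fun setT (fun w => A' w i j)) ->
    (forall i, measurable_fun setT (fun w => z' w i 0)) ->
    measurable_fun setT (fun w => phi (A' w) (z' w))) ->
  (forall B z, 0 <= phi B z) ->
  (forall z, (\int[P]_w (phi (A w) z)%:E <= (b z)%:E)%E) ->
  {ae P, forall w, (0 <= cond_exp P (sigma_mx z0)
    (fun w => (phi (A w) (z0 w))%:E) w <= (b (z0 w))%:E)%E}.
Proof.
move=> mphi phi0 phib.
pose TA := g_sigma_algebraType (mx_gen A).
pose Tz := g_sigma_algebraType (mx_gen z0).
have mz0' i j : measurable_fun setT (fun w => z0 w i j).
  by rewrite (ord1 j).
have mU : measurable_fun setT (fun w : T => (w : TA)).
  by move=> _ B mB; rewrite setTI; exact: (mx_gen_measurable mA).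
pose f (u : TA * Tz) : \bar R := (phi (A u.1) (z0 u.2))%:E.
have mf : measurable_fun setT f.
  apply/measurable_EFinP.
  apply: (@mphi _ (TA * Tz)%type (fun u => A u.1) (fun u => z0 u.2)) => [i j|i].
    apply: (@measurableT_comp _ _ _ _ _ _ (fun w : TA => A w i j) _ fst) => //.
    exact: measurable_mx_gen.
  apply: (@measurableT_comp _ _ _ _ _ _ (fun w : Tz => z0 w i 0) _ snd) => //.
  exact: measurable_mx_gen.
have f0 u : (0 <= f u)%E by rewrite lee_fin.
apply: (cond_exp_le (mx_gen_measurable mz0') mU _ mf f0 (b := b \o z0)) => //.
by move=> y; exact: (phib (z0 y)).
Qed.

End RandomMatrixSigma.

Lemma poweR_bound (R : realType) (Y : \bar R) (b p : R) :
  1 <= p -> 0 <= b -> (0 <= Y <= (b `^ p)%:E)%E -> (Y `^ p^-1 <= b%:E)%E.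
Proof.
move=> p1 b0 /andP[Y0 Yb].
have p0 : 0 < p by exact: lt_le_trans ltr01 p1.
have -> : (b%:E = (b `^ p)%:E `^ p^-1)%E.
  by rewrite poweR_EFin -powRrM mulfV ?gt_eqF// powRr1.
apply: gt0_ler_poweR => //; rewrite ?in_itv/= ?leey ?andbT//.
  by rewrite invr_ge0 ltW.
by rewrite lee_fin powR_ge0.
Qed.

Lemma indic_ler (T : Type) (R : realType) (g h : T -> R) :
  \1_[set w | g w <= h w] = (fun w => (g w <= h w)%R%:R) :> (T -> R).
Proof.
apply/funext => w; rewrite indicE; congr ((nat_of_bool _)%:R).
by apply/idP/idP; rewrite inE.
Qed.

Lemma measurable_ler_indic d (T : measurableType d) (R : realType) (g h : T -> R) :
  measurable_fun setT g -> measurable_fun setT h ->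
  measurable_fun setT (fun w => (g w <= h w)%R%:R : R).
Proof.
move=> mg mh.
rewrite -indic_ler; apply: measurable_indic.
by rewrite -[X in measurable X]setTI; exact: measurable_fun_le.
Qed.

Lemma integral_ler_indic d (T : measurableType d) (R : realType)
    (P : probability T R) (g h : T -> R) :
  measurable_fun setT g -> measurable_fun setT h ->
  (\int[P]_w (g w <= h w)%R%:R%:E = P [set w | (g w <= h w)%R])%E.
Proof.
move=> mg mh.
pose E := [set w | g w <= h w].
have mE : measurable E.
  by rewrite -[X in measurable X]setTI; exact: measurable_fun_le.
transitivity (\int[P]_w (\1_E w)%:E)%E; last by rewrite integral_indic// setIT.
by rewrite /E indic_ler.
Qed.

(** * The proposition *)

Theorem proposition6p2 (R : realType) :
  exists (c0 : R) (C : R -> R),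
    0 < c0 /\ (forall p : R, 1 <= p -> 1 < C p) /\
    forall (n t : nat) (S : {set 'I_n}) (K L : R)
      (d : measure_display) (T : measurableType d) (P : probability T R)
      (A0 : T -> 'M[R]_n) (z0 : T -> 'cV[R]_n)
      (F G : forall s : nat, 'I_n -> 'rV[R]_s -> R),
    let A (w : T) : 'M[R]_n := (Num.sqrt n%:R)^-1 *: A0 w in
    let z (w : T) : 'cV[R]_n := gfom (A w) F G (z0 w) t in
    let zS (w : T) : 'cV[R]_n := gfom (leave_out S (A w)) F G (z0 w) t in
    let sz0 := sigma_mx z0 in
    (2 <= n)%N -> (1 <= t)%N -> (0 < #|S|)%N ->
    (forall i j, measurable_fun setT (fun w => A0 w i j)) ->
    (forall i, measurable_fun setT (fun w => z0 w i 0)) ->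
    independent_sigma P (sigma_mx A) sz0 ->
    (forall w, (A0 w)^T = A0 w) ->
    mutually_independent P [set ij : 'I_n * 'I_n | (ij.1 <= ij.2)%N]%SET
      (fun ij w => A0 w ij.1 ij.2) ->
    (forall i j, ('E_P[fun w => A0 w i j] = 0)%E) ->
    2 <= K -> (forall i j, (psi2_norm P (fun w => A0 w i j) <= K%:E)%E) ->
    2 <= L ->
    (forall s : nat, (1 <= s <= t)%N -> forall l : 'I_n,
      [/\ (lip_norm (F s l) <= L%:E)%E, `|F s l 0| <= L,
          (lip_norm (G s l) <= L%:E)%E & `|G s l 0| <= L]) ->
    [/\ forall x : R, 0 <= x ->
          {ae P, forall w, (cond_prob P sz0
            [set w | (norm2 (z w - zS w) >=
               #|S|%:R * (c0 * K * L * (1 + Num.sqrt (x / n%:R))) ^+ t.+1 *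
               Num.sqrt x *
               (1 + \big[Num.max/0]_(k in S) `|z0 w k 0%R|
                  + (Num.sqrt n%:R)^-1 * norm2 (z0 w)))%R] w
            <= (c0 * t%:R * #|S|%:R * expR (- (x / c0)))%:E)%E},
        forall x : R, 0 <= x -> forall k : 'I_n,
          {ae P, forall w, (cond_prob P sz0
            [set w | (`|z w k 0%R| >=
               (c0 * K * L * (1 + Num.sqrt (x / n%:R))) ^+ t.+1 *
               (1 + Num.sqrt x) * (1 + `|z0 w|))%R] w
            <= (c0 * t%:R * expR (- (x / c0)))%:E)%E} &
        forall p : R, 1 <= p ->
          (forall k : 'I_n, {ae P, forall w,
            (cond_exp P sz0 (fun w => (`|z w k 0%R| `^ p)%:E) w `^ p^-1
             <= ((C p * t%:R * K * L) ^+ t.+1 * (1 + `|z0 w|))%:E)%E}) /\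
          {ae P, forall w,
            (cond_exp P sz0 (fun w => (`|z w| `^ p)%:E) w `^ p^-1
               * ((ln n%:R ^+ (2 * t))^-1)%:E
             <= ((C p * t%:R * K * L) ^+ t.+1 * (1 + `|z0 w|))%:E)%E}].
Proof.
exists 3072, (final_const 3072).
have c1 : 1 <= (3072 : R) by lra.
split; first exact: lt_le_trans ltr01 c1.
split; first by move=> p; exact: final_const_gt1.
move=> n t S K L d T P A0 z0 F G A z zS sz0 n2 t1 S0 mA0 mz0 indAz symA0 indA0.
move=> EA0 K2 psiK L2 lipFG.
have n0 : (0 < n)%N by exact: leq_trans n2.
have K0 : 0 < K by apply: lt_le_trans K2.
have L0 : 0 < L by apply: lt_le_trans L2.
have subA0 i j : subgaussian P (8 * K ^+ 2) (fun w => A0 w i j).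
  exact: psi2_subgaussian.
have lF : lipschitz_upto t L F.
  by move=> s st l; have [h1 h2 _ _] := lipFG s st l; split => //; exact: lip_normP.
have lG : lipschitz_upto t L G.
  by move=> s st l; have [_ _ h1 h2] := lipFG s st l; split => //; exact: lip_normP.
have mA i j : measurable_fun setT (fun w => A w i j) by exact: measurable_A.
have mgfom d' (T' : measurableType d') (A' : T' -> 'M[R]_n) (z' : T' -> 'cV[R]_n) :
    (forall i j, measurable_fun setT (fun w => A' w i j)) ->
    (forall i, measurable_fun setT (fun w => z' w i 0)) ->
    forall i, measurable_fun setT (fun w => gfom (A' w) F G (z' w) t i 0).
  by move=> mA' mz'; apply: (measurable_gfom (ltW L0) lF lG).
have mleave d' (T' : measurableType d') (A' : T' -> 'M[R]_n) :
    (forall i j, measurable_fun setT (fun w => A' w i j)) ->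
    forall i j, measurable_fun setT (fun w => leave_out S (A' w) i j).
  move=> mA' i j; under eq_fun do rewrite mxE.
  by case: (_ && _); [exact: mA'|exact: measurable_cst].
have freeze phi b := cond_exp_frozen_le mA mz0 indAz (phi := phi) (b := b).
split.
- move=> x x0.
  pose thr (v : 'cV[R]_n) := #|S|%:R *
    (3072 * K * L * (1 + Num.sqrt (x / n%:R))) ^+ t.+1 * Num.sqrt x *
    (1 + \big[Num.max/0]_(k in S) `|v k 0| + (Num.sqrt n%:R)^-1 * norm2 v).
  pose dev (B : 'M[R]_n) (v : 'cV[R]_n) :=
    norm2 (gfom B F G v t - gfom (leave_out S B) F G v t).
  have mthr d' (T' : measurableType d') (z' : T' -> 'cV[R]_n) :
      (forall i, measurable_fun setT (fun w => z' w i 0)) ->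
      measurable_fun setT (fun w => thr (z' w)).
    move=> mz'; apply: measurable_funM => //; apply: measurable_funD.
      apply: measurable_funD => //; apply: measurable_bigmax => k.
      exact: measurableT_comp.
    apply: measurable_funM => //; apply: measurable_norm2 => i j.
    by rewrite (ord1 j).
  have mdev d' (T' : measurableType d') (A' : T' -> 'M[R]_n) (z' : T' -> 'cV[R]_n) :
      (forall i j, measurable_fun setT (fun w => A' w i j)) ->
      (forall i, measurable_fun setT (fun w => z' w i 0)) ->
      measurable_fun setT (fun w => dev (A' w) (z' w)).
    move=> mA' mz'; apply: measurable_norm2 => i j; rewrite (ord1 j).
    under eq_fun do rewrite mxE [X in _ + X]mxE.
    apply: measurable_funB; apply: mgfom => //.
    exact: mleave.
  have frozen : {ae P, forall w, (0 <= cond_exp P sz0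
      (fun w => ((thr (z0 w) <= dev (A w) (z0 w))%R%:R)%:E) w <=
      (3072 * t%:R * #|S|%:R * expR (- (x / 3072)))%:E)%E}.
    apply: (freeze (fun B v => (thr v <= dev B v)%R%:R)
      (fun=> 3072 * t%:R * #|S|%:R * expR (- (x / 3072)))) => //.
      move=> d' T' A' z' mA' mz'; apply: measurable_ler_indic; first exact: mthr.
      exact: mdev.
    move=> v; rewrite integral_ler_indic//; last by apply: mdev.
    exact: (fixed_leave_out_tail n0 K2 mA0 symA0 indA0 subA0 t1 L2 lF lG v S0 x0).
  rewrite /cond_prob indic_ler.
  by move: frozen; apply: filterS => w /andP[].
- move=> x x0 k.
  pose thr (v : 'cV[R]_n) := (3072 * K * L * (1 + Num.sqrt (x / n%:R))) ^+ t.+1 *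
    (1 + Num.sqrt x) * (1 + `|v|).
  have mthr d' (T' : measurableType d') (z' : T' -> 'cV[R]_n) :
      (forall i, measurable_fun setT (fun w => z' w i 0)) ->
      measurable_fun setT (fun w => thr (z' w)).
    move=> mz'; apply: measurable_funM => //; apply: measurable_funD => //.
    exact: measurable_mx_norm.
  have frozen : {ae P, forall w, (0 <= cond_exp P sz0
      (fun w => ((thr (z0 w) <= `|gfom (A w) F G (z0 w) t k 0|)%R%:R)%:E) w <=
      (3072 * t%:R * expR (- (x / 3072)))%:E)%E}.
    apply: (freeze (fun B v => (thr v <= `|gfom B F G v t k 0|)%R%:R)
      (fun=> 3072 * t%:R * expR (- (x / 3072)))) => //.
      move=> d' T' A' z' mA' mz'; apply: measurable_ler_indic; first exact: mthr.
      by apply: measurableT_comp => //; exact: mgfom.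
    move=> v; rewrite integral_ler_indic//; last first.
      by apply: measurableT_comp => //; exact: mgfom.
    exact: (fixed_entry_tail n0 K2 mA0 symA0 indA0 subA0 t1 L2 lF lG v k x0).
  rewrite /cond_prob indic_ler.
  by move: frozen; apply: filterS => w /andP[].
move=> p p1.
pose bd (v : 'cV[R]_n) := (final_const 3072 p * t%:R * K * L) ^+ t.+1 * (1 + `|v|).
have bd0 v : 0 <= bd v.
  have f0 := ltW (lt_trans ltr01 (final_const_gt1 c1 p1)).
  by rewrite mulr_ge0 ?addr_ge0// exprn_ge0// mulr_ge0 ?(ltW L0)// mulr_ge0 ?(ltW K0)// mulr_ge0.
have Z0 (v : 'cV[R]_n) : 0 < 1 + `|v| by rewrite ltr_pwDl.
have ln0 : 0 < ln n%:R :> R.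
  by rewrite ln_gt0// ltr1n.
split.
  move=> k.
  have frozen : {ae P, forall w, (0 <= cond_exp P sz0
      (fun w => (`|gfom (A w) F G (z0 w) t k 0| `^ p)%:E) w <=
      (bd (z0 w) `^ p)%:E)%E}.
    apply: (freeze (fun B v => `|gfom B F G v t k 0| `^ p)
      (fun v => bd v `^ p)).
    + move=> d' T' A' z' mA' mz'; apply: (measurableT_comp (measurable_powR p)).
      by apply: measurableT_comp => //; exact: mgfom.
    + by move=> B v; exact: powR_ge0.
    move=> v; apply: (moment_from_tail c1 K0 L0 (Z0 v) p1 n2 t1) => //.
      by apply: measurableT_comp => //; exact: mgfom.
    move=> x x0.
    exact: (fixed_entry_tail n0 K2 mA0 symA0 indA0 subA0 t1 L2 lF lG v k x0).
  by move: frozen; apply: filterS => w; exact: poweR_bound.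
have l0 : 0 < ln n%:R ^+ (2 * t) :> R by exact: exprn_gt0.
have frozen : {ae P, forall w, (0 <= cond_exp P sz0
    (fun w => (`|gfom (A w) F G (z0 w) t| `^ p)%:E) w <=
    ((bd (z0 w) * ln n%:R ^+ (2 * t)) `^ p)%:E)%E}.
  apply: (freeze (fun B v => `|gfom B F G v t| `^ p)
    (fun v => (bd v * ln n%:R ^+ (2 * t)) `^ p)).
  + move=> d' T' A' z' mA' mz'; apply: (measurableT_comp (measurable_powR p)).
    by apply: measurable_mx_norm; exact: mgfom.
  + by move=> B v; exact: powR_ge0.
  move=> v; apply: (log_moment_from_tail c1 K0 L0 (Z0 v) p1 n2 t1) => //.
    by apply: measurable_mx_norm; exact: mgfom.
  move=> x x0.
  exact: (fixed_norm_tail n0 K2 mA0 symA0 indA0 subA0 t1 L2 lF lG v x0).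
move: frozen; apply: filterS => w /(poweR_bound p1 (mulr_ge0 (bd0 _) (ltW l0))) h.
apply: (@le_trans _ _ ((bd (z0 w) * ln n%:R ^+ (2 * t))%:E *
    ((ln n%:R ^+ (2 * t))^-1)%:E)%E).
  by apply: lee_wpmul2r => //; rewrite lee_fin invr_ge0 ltW.
by rewrite -EFinM mulfK ?gt_eqF.
Qed.
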